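(* Let $P(\theta_1,\theta_2)=1+p_1\theta_1+p_2\theta_2+p_{12}\theta_1\theta_2$ with $p_1,p_2,p_{12}>0$ and $c=\dfrac{p_1p_2-p_{12}}{p_{12}^2}>0$. Let $\lambda_1\geqslant\lambda>0$ and $\lambda_2\geqslant\lambda$. Then the multi-factor gamma distribution $\gamma_{(P,(\lambda,\lambda_1,\lambda_2))}$, i.e. the probability distribution on $\mathbb{R}^2$ with Laplace transform $$[P(\theta_1,\theta_2)]^{-\lambda}(1+p_1\theta_1)^{-(\lambda_1-\lambda)}(1+p_2\theta_2)^{-(\lambda_2-\lambda)},$$ is given by $$\gamma_{(P,(\lambda,\lambda_1,\lambda_2))}(dx_1,dx_2)=\frac{p_{12}^{-\lambda}p_1^{-(\lambda_1-\lambda)}p_2^{-(\lambda_2-\lambda)}}{\Gamma(\lambda_1)\Gamma(\lambda_2)}\,x_1^{\lambda_1-1}x_2^{\lambda_2-1}\,e^{-\left(\frac{p_2}{p_{12}}x_1+\frac{p_1}{p_{12}}x_2\right)}\,F_I\!\left(\lambda_1-\lambda,\lambda_2-\lambda,\lambda,\;c\tfrac{p_{12}}{p_1}x_1,\;c\tfrac{p_{12}}{p_2}x_2,\;c\,x_1x_2\right)\mathbf{1}_{(0,\infty)^2}(x_1,x_2)\,dx_1\,dx_2 .$$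
   Context: The Laplace transform of a probability distribution $\mu$ of a random vector $\mathbf X=(X_1,X_2)$ is $\mathbb{E}\{\exp[-(\theta_1X_1+\theta_2X_2)]\}$; that $\mu$ has a given Laplace transform means that the equality holds for a set of $\boldsymbol\theta$ with non-empty interior. $(a)_k$ is the Pochhammer symbol: $(a)_0=1$, $(a)_{k+1}=(a+k)(a)_k$ for $a\in\mathbb{R}$, $k\in\mathbb{N}$. The function $F_I$ is $$F_I(a,b,c,z_1,z_2,z_3)=\sum_{m_1,m_2,m_3=0}^{\infty}\frac{(a)_{m_1}(b)_{m_2}(c)_{m_3}}{(a+c)_{m_1+m_3}(b+c)_{m_2+m_3}}\frac{z_1^{m_1}}{m_1!}\frac{z_2^{m_2}}{m_2!}\frac{z_3^{m_3}}{m_3!}$$ (here $a,b,c$ are dummy parameters; in the claim, $c$ denotes the constant $(p_1p_2-p_{12})/p_{12}^2$). $\mathbf{1}_S$ denotes the indicator function of $S$. *)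

(* Defs.v *)
From HB Require Import structures.
From mathcomp Require Import all_boot all_order all_algebra.
From mathcomp Require Import all_classical all_reals all_analysis.

Set Implicit Arguments.
Unset Strict Implicit.
Unset Printing Implicit Defensive.

Import Order.TTheory GRing.Theory Num.Theory.
Import numFieldNormedType.Exports.

Local Open Scope classical_set_scope.
Local Open Scope ring_scope.

(* R^2 with its Borel sigma-algebra. *)
Notation plane R := (measurableTypeR R * measurableTypeR R)%type.

Fixpoint pochhammer {R : realType} (a : R) (k : nat) : R :=
  if k is k'.+1 then (a + k'%:R) * pochhammer a k' else 1.

(* Euler's integral; meaningful for 0 < a. *)
Definition Gamma {R : realType} (a : R) : R :=
  \int[@lebesgue_measure R]_(t in `]0, +oo[) (t `^ (a - 1) * expR (- t)).

Definition FI_term {R : realType} (a b c z1 z2 z3 : R) (m1 m2 m3 : nat) : R :=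
  (pochhammer a m1 * pochhammer b m2 * pochhammer c m3)
  / (pochhammer (a + c) (m1 + m3) * pochhammer (b + c) (m2 + m3))
  * (z1 ^+ m1 / m1`!%:R) * (z2 ^+ m2 / m2`!%:R) * (z3 ^+ m3 / m3`!%:R).

(* The triple series converges absolutely wherever the denominators do not
   vanish, so the order of summation is immaterial; it is summed iteratively. *)
Definition FI {R : realType} (a b c z1 z2 z3 : R) : R :=
  fine (\sum_(0 <= m1 <oo) \sum_(0 <= m2 <oo) \sum_(0 <= m3 <oo)
    (FI_term a b c z1 z2 z3 m1 m2 m3)%:E)%E.

Definition laplace {R : realType} (mu : probability (plane R) R)
    (theta : R * R) : \bar R :=
  'E_mu[fun x : plane R => expR (- (theta.1 * x.1 + theta.2 * x.2))]%E.

(* [L] is a formula for a function of theta, meaningful for theta in [D]. *)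
Definition has_laplace_transform {R : realType} (mu : probability (plane R) R)
    (D : set (R * R)) (L : R * R -> R) : Prop :=
  exists Theta : set (R * R),
    [/\ interior Theta !=set0, Theta `<=` D &
        forall theta, Theta theta -> laplace mu theta = (L theta)%:E].

Definition affine2 {R : realType} (p1 p2 p12 : R) (theta : R * R) : R :=
  1 + p1 * theta.1 + p2 * theta.2 + p12 * theta.1 * theta.2.

Definition mfg_formula {R : realType} (p1 p2 p12 lam lam1 lam2 : R)
    (theta : R * R) : R :=
  affine2 p1 p2 p12 theta `^ (- lam)
  * (1 + p1 * theta.1) `^ (- (lam1 - lam))
  * (1 + p2 * theta.2) `^ (- (lam2 - lam)).

(* [powR] has the value 1 at negative bases, so the formula above
   is only meaningful where all three bases are positive. *)
Definition mfg_domain {R : realType} (p1 p2 p12 : R) : set (R * R) :=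
  [set theta | [/\ 0 < affine2 p1 p2 p12 theta,
                   0 < 1 + p1 * theta.1 & 0 < 1 + p2 * theta.2]].

Definition is_multi_factor_gamma {R : realType} (p1 p2 p12 lam lam1 lam2 : R)
    (mu : probability (plane R) R) : Prop :=
  has_laplace_transform mu (mfg_domain p1 p2 p12)
    (mfg_formula p1 p2 p12 lam lam1 lam2).

(* Main.v *)
(* Write u = theta1 + p2/p12 and v = theta2 + p1/p12, so that
   P(theta) = p12 (u v - c), 1 + p1 theta1 = p1 (u - c p12/p1) and
   1 + p2 theta2 = p2 (v - c p12/p2).  Integrating the F_I series against
   exp(-(theta1 x1 + theta2 x2)) termwise (Tonelli) gives Gamma integrals whose
   Pochhammer factors cancel the denominators of F_I; what remains is a product
   of three negative binomial series, equal to the prescribed transform on the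
   whole domain.  In particular the density has mass 1.

   Uniqueness.  Suppose mu and the density measure nu have the same transform on
   a small box.  Expanding exponentials there shows that all moments agree, and
   the resulting power series propagates equality of one-dimensional slices of
   the transforms to any disc on which the transform of nu is finite; moving the
   centre, and alternating the two coordinates, reaches all theta >= 0.  There,
   with n -> oo, the functions exp(-exp(-n^2(x1-a)-n) - exp(-n^2(x2-b)-n)) are
   power series in decaying exponentials and tend boundedly to the indicator of
   [a, oo) x [b, oo), so mu and nu agree on a generating pi-system. *)
Require Import Defs.
From HB Require Import structures.
From mathcomp Require Import all_boot all_order all_algebra.
From mathcomp Require Import all_classical all_reals all_analysis.
From mathcomp Require Import measurable_realfun.
From mathcomp Require Import ring lra.
Import Order.TTheory GRing.Theory Num.Theory.
Import numFieldNormedType.Exports.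
Local Open Scope classical_set_scope.
Local Open Scope ring_scope.

(** * Measures agreeing on a function *)

Definition exp_psum {R : realType} (n : nat) (x : R) : R :=
  \sum_(0 <= k < n) x ^+ k / k`!%:R.

Lemma cvg_exp_psum {R : realType} (x : R) :
  exp_psum n x @[n --> \oo] --> expR x.
Proof. exact: (is_cvg_series_exp_coeff x). Qed.

Lemma exp_psum_le {R : realType} (n : nat) (x : R) :
  0 <= x -> exp_psum n x <= expR x.
Proof.
move=> x0; apply: (@nondecreasing_cvgn_le _ (fun n => exp_psum n x)).
  apply/nondecreasing_seqP => k.
  by rewrite /exp_psum big_nat_recr//= lerDl divr_ge0 ?exprn_ge0.
exact: is_cvg_series_exp_coeff.
Qed.

Lemma ler_norm_exp_psum {R : realType} (n : nat) (x : R) :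
  `|exp_psum n x| <= expR `|x|.
Proof.
apply: le_trans (exp_psum_le n _ (normr_ge0 x)).
apply: le_trans (ler_norm_sum _ _ _) _.
by apply: ler_sum => k _; rewrite normrM normrX normfV [`|_%:R|]ger0_norm.
Qed.

(** Odd powers cancel and even powers are nonnegative. This supplies nonnegative partial sums even
    where the argument changes sign, as Fatou's lemma requires in [agree_exp]. *)
Lemma exp_psum_even_ge0 {R : realType} (n : nat) (x : R) :
  0 <= exp_psum n x + exp_psum n (- x).
Proof.
rewrite -big_split/= sumr_ge0// => k _; rewrite -mulrDl divr_ge0//.
rewrite exprNn -signr_odd; case: (boolP (odd k)) => ok.
  by rewrite expr1 mulN1r subrr.
rewrite expr0 mul1r -mulr2n mulrn_wge0// -(odd_double_half k) (negbTE ok).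
by rewrite add0n -muln2 exprM sqr_ge0.
Qed.

Lemma ler_expr_expR {R : realType} (n : nat) (x : R) :
  0 <= x -> x ^+ n <= n`!%:R * expR x.
Proof.
move=> x0; rewrite mulrC -ler_pdivrMr ?ltr0n ?fact_gt0//.
apply: le_trans (exp_psum_le n.+1 _ x0); rewrite /exp_psum big_nat_recr//=.
by rewrite lerDr sumr_ge0// => k _; rewrite divr_ge0// exprn_ge0.
Qed.

(** In the tail put k = n + j and use 1 / (n + j)! <= 1 / j!. The factor |x|^n is what makes the
    quotients by t^k in [agree_moments] converge. *)
Lemma expR_remainder_le {R : realType} (n : nat) (x : R) :
  `|expR x - exp_psum n x| <= `|x| ^+ n * expR `|x|.
Proof.
have /cvg_norm h : exp_psum m x - exp_psum n x @[m --> \oo] -->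
    expR x - exp_psum n x.
  by apply: cvgB; [exact: cvg_exp_psum|exact: cvg_cst].
apply: (cvgr_to_le h); exists n => // m /= nm.
rewrite -(subnKC nm) /exp_psum (@big_cat_nat _ _ _ n 0 (n + (m - n)))//= ?leq_addr//.
rewrite addrAC subrr add0r; apply: le_trans (ler_norm_sum _ _ _) _.
rewrite -{1}(add0n n) big_addn addKn.
apply: le_trans (_ : `|x| ^+ n * exp_psum (m - n) `|x| <= _); last first.
  by rewrite ler_wpM2l ?exprn_ge0// exp_psum_le.
rewrite mulr_sumr; apply: ler_sum => k _.
rewrite normrM normrX normfV [`|_%:R|]ger0_norm// addnC exprD -mulrA.
rewrite !ler_wpM2l ?exprn_ge0// lef_pV2 ?posrE ?ltr0n ?fact_gt0// ler_nat.
by rewrite leq_fact ?leq_addl.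
Qed.

(** Integrability is part of the relation so that sums and differences can be integrated termwise.
    Below, [mu] is the unknown measure and [nu] the one whose integrals are known to be finite. *)
Definition agree {d} {T : measurableType d} {R : realType}
    (mu nu : {measure set T -> \bar R}) (h : T -> R) : Prop :=
  [/\ mu.-integrable setT (EFin \o h), nu.-integrable setT (EFin \o h) &
      (\int[mu]_x (h x)%:E = \int[nu]_x (h x)%:E)%E].

Lemma agree_ext {d} {T : measurableType d} {R : realType}
    (mu nu : {measure set T -> \bar R}) (g h : T -> R) :
  g =1 h -> agree mu nu g -> agree mu nu h.
Proof. by move=> /funext ->. Qed.

Lemma agree_measurable {d} {T : measurableType d} {R : realType}
    (mu nu : {measure set T -> \bar R}) (h : T -> R) :
  agree mu nu h -> measurable_fun setT h.
Proof. by case=> /measurable_int /measurable_EFinP. Qed.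

Lemma agree0 {d} {T : measurableType d} {R : realType}
    (mu nu : {measure set T -> \bar R}) : agree mu nu (fun=> 0).
Proof.
split; [exact: integrable0|exact: integrable0|].
by rewrite !integral0.
Qed.

Lemma agreeD {d} {T : measurableType d} {R : realType}
    (mu nu : {measure set T -> \bar R}) (g h : T -> R) :
  agree mu nu g -> agree mu nu h -> agree mu nu (fun x => g x + h x).
Proof.
move=> [mg ng eg] [mh nh eh]; split.
- exact: (integrableD measurableT mg mh).
- exact: (integrableD measurableT ng nh).
- transitivity (\int[mu]_x ((g x)%:E + (h x)%:E))%E; first by [].
  rewrite (integralD measurableT mg mh) eg eh.
  by rewrite -(integralD measurableT ng nh).
Qed.

Lemma agreeZ {d} {T : measurableType d} {R : realType}
    (mu nu : {measure set T -> \bar R}) (a : R) (h : T -> R) :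
  agree mu nu h -> agree mu nu (fun x => a * h x).
Proof.
move=> [mh nh eh]; split.
- exact: (integrableZl measurableT _ mh).
- exact: (integrableZl measurableT _ nh).
- transitivity (\int[mu]_x (a%:E * (h x)%:E))%E; first by [].
  rewrite (integralZl measurableT mh) eh.
  by rewrite -(integralZl measurableT nh).
Qed.

Lemma agreeB {d} {T : measurableType d} {R : realType}
    (mu nu : {measure set T -> \bar R}) (g h : T -> R) :
  agree mu nu g -> agree mu nu h -> agree mu nu (fun x => g x - h x).
Proof.
move=> ag /(agreeZ _ _ (-1)) /(agreeD _ _ _ _ ag).
by apply: agree_ext => x; rewrite mulN1r.
Qed.

Lemma agree_sum {d} {T : measurableType d} {R : realType}
    (mu nu : {measure set T -> \bar R}) {I : eqType} (s : seq I) (h : I -> T -> R) :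
  (forall i, i \in s -> agree mu nu (h i)) ->
  agree mu nu (fun x => \sum_(i <- s) h i x).
Proof.
elim: s => [|i s IHs] hs.
  by apply: agree_ext (agree0 mu nu) => x; rewrite big_nil.
have ai : agree mu nu (h i) by apply: hs; rewrite mem_head.
have as' : agree mu nu (fun x => \sum_(j <- s) h j x).
  by apply: IHs => j js; apply: hs; rewrite inE js orbT.
by apply: agree_ext (agreeD _ _ _ _ ai as') => x; rewrite big_cons.
Qed.

(** * Dominated limits, exponential series and moments *)

Lemma dominated_integral_cvg {d} {T : measurableType d} {R : realType}
    (mu : {measure set T -> \bar R}) (u : nat -> T -> R) (h b : T -> R) :
  (forall n, measurable_fun setT (u n)) ->
  (forall x, u n x @[n --> \oo] --> h x) ->
  (forall n x, `|u n x| <= b x) ->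
  mu.-integrable setT (EFin \o b) ->
  mu.-integrable setT (EFin \o h) /\
  (\int[mu]_x (u n x)%:E)%E @[n --> \oo] --> (\int[mu]_x (h x)%:E)%E.
Proof.
move=> mun uh ub ib.
have mh : measurable_fun setT h by exact: (measurable_fun_cvg mun).
have [] := @dominated_convergence _ T R mu setT measurableT
  (fun n => EFin \o u n) (EFin \o h) (EFin \o b) _ _ _ ib _.
- by move=> n; exact/measurable_EFinP.
- exact/measurable_EFinP.
- by apply/aeW => x _; apply/cvg_EFin; [exact: nearW|exact: uh].
- by apply/aeW => x n _; rewrite lee_fin.
by move=> ih _; split.
Qed.

Lemma agree_lim {d} {T : measurableType d} {R : realType}
    (mu nu : {measure set T -> \bar R}) (u : nat -> T -> R) (h b : T -> R) :
  (forall n, agree mu nu (u n)) ->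
  (forall x, u n x @[n --> \oo] --> h x) ->
  (forall n x, `|u n x| <= b x) ->
  mu.-integrable setT (EFin \o b) -> nu.-integrable setT (EFin \o b) ->
  agree mu nu h.
Proof.
move=> au uh ub mb nb.
have mun n := agree_measurable _ _ _ (au n).
have [mh cm] := dominated_integral_cvg mu u h b mun uh ub mb.
have [nh cn] := dominated_integral_cvg nu u h b mun uh ub nb.
split=> //; apply: (@cvg_unique _ (@ereal_hausdorff R) _ _ _ _ cm).
rewrite (_ : (fun n => _) = (fun n => \int[nu]_x (u n x)%:E)%E)//.
by apply/funext => n; have [] := au n.
Qed.

(** Integrability of [expR |h| * g] is assumed for [nu] alone. Fatou's lemma transfers it to [mu]
    along the even part of the exponential series, whose integrals agree; dominated convergence of
    the full series then finishes. *)
Lemma agree_exp {d} {T : measurableType d} {R : realType}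
    (mu nu : {measure set T -> \bar R}) (h g : T -> R) :
  measurable_fun setT h -> measurable_fun setT g -> (forall x, 0 <= g x) ->
  (forall k, agree mu nu (fun x => h x ^+ k * g x)) ->
  nu.-integrable setT (EFin \o (fun x => expR `|h x| * g x)) ->
  agree mu nu (fun x => expR (h x) * g x).
Proof.
move=> mh mg g0 hk iexp.
pose S n x := exp_psum n (h x) * g x.
have aS n : agree mu nu (S n).
  suff : agree mu nu (fun x =>
      \sum_(k <- index_iota 0 n) k`!%:R^-1 * (h x ^+ k * g x)).
    apply: agree_ext => x; rewrite /S /exp_psum mulr_suml.
    by apply: eq_bigr => k _; rewrite mulrA [_^-1 * _]mulrC.
  by apply: agree_sum => k _; exact/agreeZ/hk.
pose S' n x := (exp_psum n (h x) + exp_psum n (- h x)) * g x.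
have aS' n : agree mu nu (S' n).
  suff : agree mu nu (fun x => \sum_(k <- index_iota 0 n)
      (1 + (-1) ^+ k) * k`!%:R^-1 * (h x ^+ k * g x)).
    apply: agree_ext => x; rewrite /S' /exp_psum -big_split/= mulr_suml.
    apply: eq_bigr => k _; rewrite (exprNn (h x)); ring.
  by apply: agree_sum => k _; exact/agreeZ/hk.
pose b x := (expR (h x) + expR (- h x)) * g x.
have S'b x : S' n x @[n --> \oo] --> b x.
  by apply: cvgM; [apply: cvgD; exact: cvg_exp_psum|exact: cvg_cst].
have S'_le n x : `|S' n x| <= 2 * (expR `|h x| * g x).
  rewrite normrM (ger0_norm (g0 x)) mulrA ler_wpM2r// (le_trans (ler_normD _ _))//.
  rewrite mulr_natl mulr2n lerD ?ler_norm_exp_psum//.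
  by apply: le_trans (ler_norm_exp_psum _ _) _; rewrite normrN.
have [inub cb] := dominated_integral_cvg nu S' b _
  (fun n => agree_measurable _ _ _ (aS' n)) S'b S'_le (integrableZl measurableT 2 iexp).
have mb : measurable_fun setT b by apply/measurable_EFinP; exact: measurable_int inub.
have b0 x : 0 <= b x by rewrite mulr_ge0// addr_ge0// expR_ge0.
(* The [mu]-integrals of [S'] equal its [nu]-integrals, which converge to the finite [nu]-integral
   of [b], so Fatou bounds the [mu]-integral of [b]. *)
have imub : mu.-integrable setT (EFin \o b).
  apply/integrableP; split; first exact/measurable_EFinP.
  under eq_integral do rewrite /= ger0_norm//.
  have := @fatou _ T R mu setT measurableT (fun n => EFin \o S' n) _ _.
  rewrite (eq_integral (EFin \o b)); last first.
    move=> x _; rewrite is_cvg_limn_einfE.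
      by apply/cvg_lim => //; apply/cvg_EFin; [exact: nearW|exact: S'b].
    by apply/cvg_ex; exists (b x)%:E; apply/cvg_EFin; [exact: nearW|exact: S'b].
  move=> F; apply: le_lt_trans (F _ _) _.
  - by move=> n; apply/measurable_EFinP; exact: agree_measurable (aS' n).
  - by move=> n x _; rewrite lee_fin mulr_ge0// exp_psum_even_ge0.
  rewrite (_ : (fun n => _) = (fun n => \int[nu]_x (S' n x)%:E)%E); last first.
    by apply/funext => n; have [] := aS' n.
  rewrite is_cvg_limn_einfE; last by apply/cvg_ex; exists (\int[nu]_x (b x)%:E)%E.
  rewrite (cvg_lim _ cb)//; apply: integrable_lty => //.
have imu : mu.-integrable setT (EFin \o (fun x => expR `|h x| * g x)).
  apply: le_integrable imub => //.
    apply/measurable_EFinP/measurable_funM => //.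
    by apply: measurableT_comp => //; exact: measurableT_comp.
  move=> x _; rewrite /= lee_fin (ger0_norm (b0 x)) ger0_norm; last first.
    by rewrite mulr_ge0// expR_ge0.
  by rewrite ler_wpM2r//; case: (ger0P (h x)) => _; rewrite ?lerDl ?lerDr expR_ge0.
apply: (agree_lim mu nu S _ _ aS _ _ imu iexp).
- by move=> x; apply: cvgM; [exact: cvg_exp_psum|exact: cvg_cst].
- by move=> n x; rewrite normrM (ger0_norm (g0 x)) ler_wpM2r// ler_norm_exp_psum.
Qed.

(** Induction on k: the function f^k g is k! times the limit, as t decreases to 0, of t^-k times the
    remainder of expR (t f) after its terms of degree below k, weighted by g. The subtracted terms
    are covered by the induction hypothesis. *)
Lemma agree_moments {d} {T : measurableType d} {R : realType}
    (mu nu : {measure set T -> \bar R}) (f g : T -> R) (r : R) :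
  0 < r -> (forall x, 0 <= g x) ->
  (forall t, `|t| < r -> agree mu nu (fun x => expR (t * f x) * g x)) ->
  forall k, agree mu nu (fun x => f x ^+ k * g x).
Proof.
move=> r0 g0 ag; elim/ltn_ind => k IHk.
(* The choice 2 s < r keeps the dominating exponentials at 2 s and -2 s in the range where agreement
   is assumed. *)
have [s s0 sr] : exists2 s, 0 < s & s * 2 < r by exists (r / 3); lra.
have [t [t0 ts tcvg]] : exists t : nat -> R,
    [/\ forall n, 0 < t n, forall n, t n <= s & t n @[n --> \oo] --> 0].
  exists (fun n => s * n.+1%:R^-1); split=> [n|n|].
  - by rewrite mulr_gt0// invr_gt0.
  - by rewrite ger_pMr// invf_le1// ler1n.
  - by rewrite -(mulr0 s); apply: cvgM; [exact: cvg_cst|exact: cvg_harmonic].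
have fs x m : `|f x| ^+ m <= m`!%:R / s ^+ m * expR (s * `|f x|).
  rewrite mulrAC ler_pdivlMr ?exprn_gt0// -exprMn [`|f x| * s]mulrC.
  by rewrite ler_expr_expR// mulr_ge0// ltW.
pose u n x := (t n ^- k) * ((expR (t n * f x) - exp_psum k (t n * f x)) * g x).
have au n : agree mu nu (u n).
  apply: agreeZ; suff : agree mu nu (fun x => expR (t n * f x) * g x -
      \sum_(j <- index_iota 0 k) (t n ^+ j / j`!%:R) * (f x ^+ j * g x)).
    apply: agree_ext => x; rewrite mulrBl; congr (_ - _).
    rewrite /exp_psum mulr_suml; apply: eq_bigr => j _.
    by rewrite exprMn; ring.
  apply: agreeB.
    by apply: ag; rewrite gtr0_norm// (le_lt_trans (ts n))//; lra.
  apply: agree_sum => j; rewrite mem_index_iota => /andP[_ jk].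
  by apply: agreeZ; exact: IHk.
(* The remainder bound gives |f|^k expR (s |f|), and |f|^k is at most k! / s^k times another expR (s
   |f|). The product expR (2 s |f|) is below the sum of the exponentials at 2 s and -2 s. *)
pose b x := k`!%:R / s ^+ k * (expR (2 * s * f x) * g x + expR (- (2 * s) * f x) * g x).
have ab : agree mu nu b.
  by apply/agreeZ/agreeD; apply: ag; rewrite ?normrN gtr0_norm ?mulr_gt0//; lra.
have lee2 x : expR (s * `|f x|) * expR (s * `|f x|) <=
    expR (2 * s * f x) + expR (- (2 * s) * f x).
  rewrite -expRD; case: (ger0P (f x)) => _.
    rewrite (_ : s * f x + s * f x = 2 * s * f x); last by ring.
    by rewrite lerDl expR_ge0.
  rewrite (_ : s * - f x + s * - f x = - (2 * s) * f x); last by ring.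
  by rewrite lerDr expR_ge0.
suff : agree mu nu (fun x => k`!%:R^-1 * (f x ^+ k * g x)).
  move/(agreeZ _ _ k`!%:R); apply: agree_ext => x.
  by rewrite mulrA divff ?mul1r// pnatr_eq0 -lt0n fact_gt0.
have [mub nub _] := ab.
have expts x n : expR (t n * `|f x|) <= expR (s * `|f x|).
  by rewrite ler_expR ler_wpM2r.
apply: (agree_lim mu nu u _ b au _ _ mub nub).
- move=> x; apply/subr_cvg0/norm_cvg0P.
  (* The difference to the limit is t^-k times the remainder of order k + 1, hence at most t K. *)
  pose K := `|f x| ^+ k.+1 * expR (s * `|f x|) * g x.
  apply: (@squeeze_cvgr _ _ _ _ (fun=> 0) (fun n => t n * K)).
  + apply: nearW => n; rewrite normr_ge0/=.
    have -> : u n x - k`!%:R^-1 * (f x ^+ k * g x) =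
        t n ^- k * ((expR (t n * f x) - exp_psum k.+1 (t n * f x)) * g x).
      rewrite /u /exp_psum big_nat_recr//= opprD addrA [in RHS]mulrBl mulrBr.
      have tk : t n ^+ k != 0 by rewrite expf_neq0// lt0r_neq0.
      have fk : k`!%:R != 0 :> R by rewrite pnatr_eq0 -lt0n fact_gt0.
      congr (_ - _); rewrite exprMn; field; exact/andP.
    rewrite !normrM (ger0_norm (g0 x)) normfV (ger0_norm (exprn_ge0 k (ltW (t0 n)))).
    rewrite mulrA /K [leRHS]mulrA; apply: ler_wpM2r => //.
    rewrite ler_pdivrMl ?exprn_gt0//.
    apply: le_trans (expR_remainder_le _ _) _.
    rewrite normrM (gtr0_norm (t0 n)) exprMn [t n ^+ k.+1]exprSr -!mulrA.
    apply: ler_wpM2l; first by rewrite exprn_ge0// ltW.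
    apply: ler_wpM2l; first exact: ltW.
    by apply: ler_wpM2l; rewrite ?exprn_ge0.
  + exact: cvg_cst.
  + rewrite -(mul0r K); by apply: cvgM => //; exact: cvg_cst.
- move=> n x; rewrite /u !normrM (ger0_norm (g0 x)) normfV (ger0_norm (exprn_ge0 k (ltW (t0 n)))).
  rewrite /b -mulrDl mulrA [leRHS]mulrA; apply: ler_wpM2r => //.
  rewrite ler_pdivrMl ?exprn_gt0//.
  apply: le_trans (expR_remainder_le _ _) _.
  rewrite normrM (gtr0_norm (t0 n)) exprMn -[leLHS]mulrA.
  apply: ler_wpM2l; first by rewrite exprn_ge0// ltW.
  apply: le_trans (_ : _ <= k`!%:R / s ^+ k * expR (s * `|f x|) * expR (s * `|f x|)) _.
    by apply: ler_pM; rewrite ?exprn_ge0 ?expR_ge0.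
  rewrite -mulrA; apply: ler_wpM2l => //.
  by rewrite divr_ge0// exprn_ge0// ltW.
Qed.

(** Agreement near 0 gives all moments, and these determine the integral of expR (t f) g as soon as
    expR |t f| g is [nu]-integrable. That holds because expR |t f| is at most the sum of the
    exponentials at t and -t. *)
Lemma agree_extend {d} {T : measurableType d} {R : realType}
    (mu nu : {measure set T -> \bar R}) (f g : T -> R) (r r' : R) :
  measurable_fun setT f -> (forall x, 0 <= g x) -> 0 < r ->
  (forall t, `|t| < r -> agree mu nu (fun x => expR (t * f x) * g x)) ->
  (forall t, `|t| < r' ->
     nu.-integrable setT (EFin \o (fun x => expR (t * f x) * g x))) ->
  forall t, `|t| < r' -> agree mu nu (fun x => expR (t * f x) * g x).
Proof.
move=> mf g0 r0 ag ing t tr'.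
have mg : measurable_fun setT g.
  have /agree_measurable : agree mu nu (fun x => expR (0 * f x) * g x).
    by apply: ag; rewrite normr0.
  by congr measurable_fun; apply/funext => x; rewrite mul0r expR0 mul1r.
have mtf : measurable_fun setT (fun x => t * f x) by exact: measurable_funM.
apply: agree_exp => //.
  move=> k; suff : agree mu nu (fun x => t ^+ k * (f x ^+ k * g x)).
    by apply: agree_ext => x; rewrite exprMn mulrA.
  by apply: agreeZ; exact: agree_moments ag k.
have tNr' : `|- t| < r' by rewrite normrN.
apply: (le_integrable measurableT _ _ (integrableD measurableT (ing _ tr') (ing _ tNr'))).
  apply/measurable_EFinP/measurable_funM => //.
  by apply: measurableT_comp => //; exact: measurableT_comp.
move=> x _; rewrite /= lee_fin -mulrDl mulNr.
have e0 : 0 <= expR (t * f x) + expR (- (t * f x)) by rewrite addr_ge0 ?expR_ge0.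
rewrite (ger0_norm (mulr_ge0 e0 (g0 x))) ger0_norm ?mulr_ge0 ?expR_ge0// ler_wpM2r//.
by case: (ger0P (t * f x)) => _; rewrite ?lerDl ?lerDr expR_ge0.
Qed.

(** Recentring at [t0] absorbs the positive factor expR (- (t0 f)) into the weight [g]. *)
Lemma agree_extend_center {d} {T : measurableType d} {R : realType}
    (mu nu : {measure set T -> \bar R}) (f g : T -> R) (t0 r r' : R) :
  measurable_fun setT f -> (forall x, 0 <= g x) -> 0 < r ->
  (forall t, `|t - t0| < r -> agree mu nu (fun x => expR (- (t * f x)) * g x)) ->
  (forall t, `|t - t0| < r' ->
     nu.-integrable setT (EFin \o (fun x => expR (- (t * f x)) * g x))) ->
  forall t, `|t - t0| < r' -> agree mu nu (fun x => expR (- (t * f x)) * g x).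
Proof.
move=> mf g0 r0 ag ing t tr'.
have shift s : (fun x => expR (- (s * f x)) * g x) =
    (fun x => expR ((s - t0) * (- f x)) * (expR (- (t0 * f x)) * g x)).
  apply/funext => x; rewrite mulrA -expRD; congr (expR _ * _); ring.
have ag' s : `|s| < r -> agree mu nu
    (fun x => expR (s * (- f x)) * (expR (- (t0 * f x)) * g x)).
  by move=> sr; have := ag (s + t0); rewrite shift !addrK; exact.
have ing' s : `|s| < r' -> nu.-integrable setT
    (EFin \o (fun x => expR (s * (- f x)) * (expR (- (t0 * f x)) * g x))).
  by move=> sr; have := ing (s + t0); rewrite shift !addrK; exact.
rewrite shift; apply: (agree_extend mu nu _ _ r r') => //.
- exact: measurableT_comp.
- by move=> x; rewrite mulr_ge0 ?expR_ge0.
Qed.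

(** A chain of discs inside the half-line t > a: each starts from a smaller concentric interval
    already reached. All left ends stay at [a] while the right ends go to infinity. *)
Lemma agree_extend_ray {d} {T : measurableType d} {R : realType}
    (mu nu : {measure set T -> \bar R}) (f g : T -> R) (a b b' : R) :
  measurable_fun setT f -> (forall x, 0 <= g x) -> a <= b -> b < b' ->
  (forall t, b < t < b' -> agree mu nu (fun x => expR (- (t * f x)) * g x)) ->
  (forall t, a < t ->
     nu.-integrable setT (EFin \o (fun x => expR (- (t * f x)) * g x))) ->
  forall t, a < t -> agree mu nu (fun x => expR (- (t * f x)) * g x).
Proof.
move=> mf g0 ab bb' ag ing.
(* The first disc is centred at the midpoint of [b] and [b'] and has radius [rho], so it reaches
   down to [a]. *)
have [rho rho0 rhoE] : exists2 rho, 0 < rho & a + rho = (b + b') / 2.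
  by exists ((b + b') / 2 - a); lra.
have agn n : forall t, a < t < a + n.+2%:R * rho ->
    agree mu nu (fun x => expR (- (t * f x)) * g x).
  elim: n => [|n IHn] t /andP[at_ tn].
    apply: (agree_extend_center mu nu f g (a + rho) ((b' - b) / 2) rho) => //.
    - lra.
    - move=> s; rewrite ltr_norml => /andP[s1 s2]; apply: ag; lra.
    - move=> s; rewrite ltr_norml => /andP[s1 s2]; apply: ing; lra.
    - rewrite ltr_norml; lra.
  (* The disc of centre a + q and radius q is the interval from a to a + (n + 3) rho. The concentric
     interval of radius (n + 1) rho / 2 runs from a + rho to a + (n + 2) rho, where [IHn]
     applies. *)
  pose q := n.+3%:R * rho / 2.
  have n1 : 0 < n.+1%:R * rho by rewrite mulr_gt0.
  have n2E : n.+2%:R * rho = n.+1%:R * rho + rho.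
    by rewrite -natr1 mulrDl mul1r.
  have n3E : n.+3%:R * rho = n.+1%:R * rho + 2 * rho.
    by rewrite -2!natr1; ring.
  apply: (agree_extend_center mu nu f g (a + q) (n.+1%:R * rho / 2) q) => //.
  - lra.
  - move=> s; rewrite ltr_norml => /andP[s1 s2]; apply: IHn; rewrite /q in s1 s2; lra.
  - move=> s; rewrite ltr_norml => /andP[s1 s2]; apply: ing; rewrite /q in s1 s2; lra.
  - rewrite ltr_norml /q; lra.
move=> t at_; apply: (agn (Num.truncn ((t - a) / rho))).
rewrite at_/= -ltrBlDl -ltr_pdivrMr//.
have h : 0 <= (t - a) / rho by rewrite divr_ge0 ?(ltW rho0)//; lra.
have /andP[_ /lt_le_trans] := truncn_itv h; apply.
by rewrite ler_nat.
Qed.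

(** * Uniqueness of bivariate Laplace transforms *)

Definition upper_quadrant {R : realType} (p : R * R) : set (plane R) :=
  `[p.1, +oo[ `*` `[p.2, +oo[.

Lemma measurable_upper_quadrant {R : realType} (p : R * R) :
  measurable (upper_quadrant p).
Proof. by apply: measurableX; exact: measurable_itv. Qed.

(** Half-planes are countable unions of quadrants whose other corner coordinate goes to minus
    infinity. Hence both projections are measurable for the generated sigma-algebra, and it contains
    all measurable rectangles. *)
Lemma measurable_planeE {R : realType} :
  @measurable _ (plane R) = <<s range (@upper_quadrant R) >>.
Proof.
rewrite eqEsubset; split; last first.
  apply: smallest_sub; first exact: sigma_algebra_measurable.
  by move=> _ [p _ <-]; exact: measurable_upper_quadrant.
pose gT : measurableType _ := g_sigma_algebraType (range (@upper_quadrant R)).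
have mq p : @measurable _ gT (upper_quadrant p).
  by apply: sub_sigma_algebra; exists p.
have geN (y : R) : - (Num.truncn `|y|).+1%:R <= y.
  rewrite lerNl (le_trans (ler_norm _))// normrN ltW//.
  by have /andP[] := truncn_itv (normr_ge0 y).
have mfst : @measurable_fun _ _ gT R setT fst.
  apply: (measurability _ (RGenCInfty.measurableE R)) => _ [_ [a ->] <-].
  rewrite setTI [X in measurable X](_ : _ =
      \bigcup_k upper_quadrant (a, - k.+1%:R)); first exact: bigcupT_measurable.
  apply/seteqP; split => [[x y]|[x y] [k _ []]]; rewrite /= !in_itv/= !andbT//.
  by move=> ax; exists (Num.truncn `|y|) => //; split; rewrite /= in_itv/= andbT.
have msnd : @measurable_fun _ _ gT R setT snd.
  apply: (measurability _ (RGenCInfty.measurableE R)) => _ [_ [a ->] <-].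
  rewrite setTI [X in measurable X](_ : _ =
      \bigcup_k upper_quadrant (- k.+1%:R, a)); first exact: bigcupT_measurable.
  apply/seteqP; split => [[x y]|[x y] [k _ []]]; rewrite /= !in_itv/= !andbT//.
  by move=> ax; exists (Num.truncn `|x|) => //; split; rewrite /= in_itv/= andbT.
rewrite measurable_prod_measurableType.
apply: smallest_sub; first exact: smallest_sigma_algebra.
move=> _ [A mA [B mB <-]].
have -> : A `*` B = (fst @^-1` A) `&` (snd @^-1` B) by [].
apply: (@measurableI _ gT); rewrite -[X in measurable X]setTI.
- exact: mfst.
- exact: msnd.
Qed.

(** Quadrants form a pi-system, the corner of an intersection being the coordinatewise maximum, and
    those with corners (-(k + 1), -(k + 1)) exhaust the plane. *)
Lemma upper_quadrant_measure_eq {R : realType}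
    (mu nu : {measure set (plane R) -> \bar R}) :
  (mu setT < +oo)%E ->
  (forall p, mu (upper_quadrant p) = nu (upper_quadrant p)) ->
  forall A : set (plane R), measurable A -> mu A = nu A.
Proof.
move=> mufin mn.
apply: (measure_unique (range (@upper_quadrant R))
  (fun k => upper_quadrant (- k.+1%:R, - k.+1%:R))).
- exact: measurable_planeE.
- move=> _ _ [p _ <-] [q _ <-].
  exists (Num.max p.1 q.1, Num.max p.2 q.2) => //.
  apply/seteqP; split=> -[x y]; rewrite /upper_quadrant/= !in_itv/= !andbT !ge_max.
    by move=> [/andP[? ?] /andP[? ?]].
  by move=> [[-> ->] [-> ->]].
- by move=> k; exists (- k.+1%:R, - k.+1%:R).
- apply/seteqP; split => // -[x y] _.
  have h (z : R) (k : nat) : (Num.truncn `|z| <= k)%N -> - k.+1%:R <= z.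
    move=> zk; rewrite lerNl (le_trans (ler_norm _))// normrN ltW//.
    have /andP[_ /lt_le_trans] := truncn_itv (normr_ge0 z); apply.
    by rewrite ler_nat.
  exists (maxn (Num.truncn `|x|) (Num.truncn `|y|)) => //.
  by split; rewrite /= in_itv/= andbT; apply: h; rewrite ?leq_maxl ?leq_maxr.
- by move=> _ [p _ <-].
- move=> k; apply: le_lt_trans mufin; apply: le_measure; rewrite ?inE//.
  exact: measurable_upper_quadrant.
Qed.

(* [cutoff n y] tends to 0 for [0 <= y] and to [+oo] for [y < 0], so
   [expR (- cutoff n y)] tends to the indicator of [0 <= y]; as a function of
   [x], a power of [cutoff n (x - a)] is a multiple of a decaying exponential. *)
Definition cutoff {R : realType} (n : nat) (y : R) : R :=
  expR (- (n%:R ^+ 2 * y + n%:R)).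

Lemma cutoff_ge0 {R : realType} n (y : R) : 0 <= cutoff n y.
Proof. exact: expR_ge0. Qed.

(** At y = 0 it is the shift by n in the exponent that forces the limit 0; so the limiting quadrant
    is closed. *)
Lemma cvg_cutoff0 {R : realType} (y : R) :
  0 <= y -> cutoff n y @[n --> \oo] --> (0 : R).
Proof.
move=> y0; apply: (@squeeze_cvgr _ _ _ _ (fun=> 0) (fun n => expR (- n%:R))).
- apply: nearW => n; rewrite cutoff_ge0/= ler_expR lerN2 lerDr.
  by rewrite mulr_ge0 ?exprn_ge0.
- exact: cvg_cst.
- exact: cvgn_expR.
Qed.

(** Once n (-y) >= 2, the exponent n (n (-y) - 1) is at least n. *)
Lemma cutoff_ge {R : realType} (y : R) :
  y < 0 -> \forall n \near \oo, n%:R <= cutoff n y.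
Proof.
move=> y0; exists (Num.truncn (2 / - y)).+1 => // n /= yn.
have h : 2 <= n%:R * - y.
  rewrite -ler_pdivrMr ?oppr_gt0//.
  have h0 : 0 <= 2 / - y by rewrite divr_ge0// oppr_ge0 ltW.
  have /andP[_ /ltW /le_trans] := truncn_itv h0; apply.
  by rewrite ler_nat.
apply: le_trans (_ : expR n%:R <= _); last first.
  rewrite ler_expR expr2 -mulrA opprD -mulrN -mulrN.
  have := ler_wpM2l (ler0n R n) h; lra.
by apply: le_trans (expR_ge1Dx _); rewrite lerDr.
Qed.

Lemma cvg_expRN_cutoff {R : realType} (p x : R * R) :
  expR (- (cutoff n (x.1 - p.1) + cutoff n (x.2 - p.2))) @[n --> \oo]
    --> (\1_(upper_quadrant p) x : R).
Proof.
have big0 (u : nat -> R) : (\forall n \near \oo, n%:R <= u n) ->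
    expR (- u n) @[n --> \oo] --> (0 : R).
  move=> un; apply: (@squeeze_cvgr _ _ _ _ (fun=> 0) (fun n => expR (- n%:R))).
  - near=> n; rewrite expR_ge0/= ler_expR lerN2; near: n; exact: un.
  - exact: cvg_cst.
  - exact: cvgn_expR.
rewrite indicE; have [x1|x1] := leP 0 (x.1 - p.1).
  have [x2|x2] := leP 0 (x.2 - p.2).
    rewrite mem_set/=; last by split; rewrite /= in_itv/= andbT -subr_ge0.
    have : - (cutoff n (x.1 - p.1) + cutoff n (x.2 - p.2)) @[n --> \oo] -->
        (- (0 + 0) : R).
      by apply: cvgN; apply: cvgD; exact: cvg_cutoff0.
    rewrite addr0 oppr0 => /(continuous_cvg _ (@continuous_expR R 0)).
    by rewrite expR0.
  rewrite memNset/=; last by move=> [_]; rewrite /= in_itv/= andbT -subr_ge0 leNgt x2.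
  apply: big0; near=> n; apply: le_trans (_ : cutoff n (x.2 - p.2) <= _).
    near: n; exact: (cutoff_ge _ x2).
  by rewrite lerDr cutoff_ge0.
rewrite memNset/=; last by move=> [+ _]; rewrite /= in_itv/= andbT -subr_ge0 leNgt x1.
apply: big0; near=> n; apply: le_trans (_ : cutoff n (x.1 - p.1) <= _).
  near: n; exact: (cutoff_ge _ x1).
by rewrite lerDl cutoff_ge0.
Unshelve. all: by end_near. Qed.

Lemma measurable_cutoff {R : realType} (n : nat) (a : R) :
  measurable_fun setT (fun x : R => cutoff n (x - a)).
Proof.
rewrite /cutoff; apply: measurableT_comp => //.
apply: measurable_funN; apply: measurable_funD => //.
by apply: measurable_funM => //; exact: measurable_funB.
Qed.

(** [agree_exp] is applied with exponent -S and weight 1. Its integrability hypothesis concerns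
    [nu], which lives on the open positive quadrant, where S is bounded; no such support condition
    is known for [mu]. *)
Lemma agree_quadrant {R : realType}
    (mu nu : {measure set (plane R) -> \bar R}) :
  (forall s t, 0 <= s -> 0 <= t ->
    agree mu nu (fun x : plane R => expR (- (s * x.1 + t * x.2)))) ->
  nu (~` (`]0, +oo[ `*` `]0, +oo[)) = 0%E ->
  forall p, mu (upper_quadrant p) = nu (upper_quadrant p).
Proof.
move=> ag nu0 p.
have a1 : agree mu nu (fun=> 1).
  by apply: agree_ext (ag 0 0 _ _) => // x; rewrite !mul0r addr0 oppr0 expR0.
pose S n (x : plane R) := cutoff n (x.1 - p.1) + cutoff n (x.2 - p.2).
have S0 n x : 0 <= S n x by rewrite addr_ge0 ?cutoff_ge0.
have mS n : measurable_fun setT (S n).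
  apply: measurable_funD.
    exact: (measurableT_comp (measurable_cutoff n p.1) measurable_fst).
  exact: (measurableT_comp (measurable_cutoff n p.2) measurable_snd).
have aS n : agree mu nu (fun x => expR (- S n x)).
  suff : agree mu nu (fun x => expR (- S n x) * 1).
    by apply: agree_ext => x; rewrite mulr1.
  apply: agree_exp => //; first exact: measurable_funN.
  - move=> k.
    (* Binomial theorem: cutoff n (x - p) is expR (n^2 p - n) times expR (- n^2 x), so each power of
       S is a combination of exponentials with nonnegative rates, covered by [ag]. *)
    suff : agree mu nu (fun x => (-1) ^+ k * \sum_(i < k.+1)
       ('C(k, i)%:R * expR ((k - i)%:R * (n%:R ^+ 2 * p.1 - n%:R)
          + i%:R * (n%:R ^+ 2 * p.2 - n%:R))) *
       expR (- ((k - i)%:R * n%:R ^+ 2 * x.1 + i%:R * n%:R ^+ 2 * x.2))).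
      apply: agree_ext => x; rewrite mulr1 (exprNn (S n x)) /S exprDn; congr (_ * _).
      apply: eq_bigr => i _; rewrite -[RHS]mulr_natl -mulrA -expRD.
      congr (_ * _).
      rewrite /cutoff -!expRM_natl -expRD; congr expR; ring.
    apply: agreeZ; apply: agree_sum => i _; apply: agreeZ; apply: ag.
      by rewrite mulr_ge0// exprn_ge0.
    by rewrite mulr_ge0// exprn_ge0.
  - have mQ : measurable (`]0, +oo[ `*` `]0, +oo[ : set (plane R)).
      by apply: measurableX; exact: measurable_itv.
    have mF : measurable_fun setT (fun x : plane R => expR `|- S n x| * 1).
      apply: measurable_funM => //; apply: measurableT_comp => //.
      by apply: measurableT_comp => //; exact: measurable_funN.
    apply/(negligible_integrable (measurableC mQ) measurableT _ nu0).
      exact/measurable_EFinP.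
    apply: measurable_bounded_integrable.
    + by apply: measurableD => //; exact: measurableC.
    + have [_ /integrable_lty + _] := a1.
      move=> /(_ measurableT); apply: le_lt_trans.
      rewrite [leRHS](_ : _ = nu setT); last first.
        by rewrite (eq_integral (cst 1%E))// integral_cst// mul1e.
      apply: le_measure; rewrite ?inE//.
      by apply: measurableD => //; exact: measurableC.
    + exact: measurable_funTS.
    (* [cutoff n] is nonincreasing, so over the positive quadrant each summand of S is at most its
       value at coordinate 0. *)
    exists (expR (cutoff n (- p.1) + cutoff n (- p.2))); split=> [|M leM].
      exact: num_real.
    move=> x; rewrite setDE setCK setTI => -[]; rewrite /= !in_itv/= !andbT => x1 x2.
    rewrite mulr1 normrN (ger0_norm (S0 n x)) ger0_norm ?expR_ge0//.
    apply: le_trans (ltW leM); rewrite ler_expR lerD// ler_expR lerN2 lerD2r;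
      by rewrite ler_wpM2l ?exprn_ge0// lerDr ltW.
have [_ _] : agree mu nu (\1_(upper_quadrant p)).
  have [mu1 nu1 _] := a1.
  apply: (agree_lim mu nu _ _ (fun=> 1) aS _ _ mu1 nu1).
    by move=> x; exact: cvg_expRN_cutoff.
  by move=> n x; rewrite ger0_norm ?expR_ge0// expR_le1 oppr_le0.
by rewrite !integral_indic ?setIT//; exact: measurable_upper_quadrant.
Qed.

(** * Propagation of agreement in the plane *)

Definition exp_form {R : realType} (theta : R * R) (x : plane R) : R :=
  expR (- (theta.1 * x.1 + theta.2 * x.2)).

(** Upward closure keeps the rays used here inside [D]. The box at [q] is first extended to
    everything beyond [q]; then, at heights above both [q] and [d], the first coordinate is lowered
    to that of [d], and finally the second. *)
Lemma agree_exp_form_extend {R : realType}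
    (mu nu : {measure set (plane R) -> \bar R}) (D : set (R * R))
    (q d : R * R) (r : R) :
  0 < r ->
  (forall s t, D s -> s.1 <= t.1 -> s.2 <= t.2 -> D t) ->
  (forall t, D t -> nu.-integrable setT (EFin \o exp_form t)) ->
  (forall t, q.1 <= t.1 < q.1 + r -> q.2 <= t.2 < q.2 + r ->
     D t /\ agree mu nu (exp_form t)) ->
  D d -> forall t, d.1 < t.1 -> d.2 < t.2 -> agree mu nu (exp_form t).
Proof.
move=> r0 upD inu agb Dd.
have E1 t1 t2 : (fun x : plane R => expR (- (t1 * x.1)) * expR (- (t2 * x.2)))
    = exp_form (t1, t2).
  by apply/funext => x; rewrite /exp_form -expRD opprD.
have E2 t1 t2 : (fun x : plane R => expR (- (t2 * x.2)) * expR (- (t1 * x.1)))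
    = exp_form (t1, t2).
  by apply/funext => x; rewrite /exp_form -expRD opprD addrC.
have Dq : D q by case: (agb q) => //; lra.
have ray1 t2 a b b' : a <= b -> b < b' -> D (a, t2) ->
    (forall t1, b < t1 < b' -> agree mu nu (exp_form (t1, t2))) ->
    forall t1, a < t1 -> agree mu nu (exp_form (t1, t2)).
  move=> ab bb' Da ag t1 at1; rewrite -E1.
  apply: (agree_extend_ray mu nu (fun x => x.1) (fun x => expR (- (t2 * x.2))) a b b') => //.
  - exact: measurable_fst.
  - by move=> s sb; rewrite E1; exact: ag.
  - by move=> s as_; rewrite E1; apply: inu; apply: upD Da _ _ => //=; exact: ltW.
have ray2 t1 a b b' : a <= b -> b < b' -> D (t1, a) ->
    (forall t2, b < t2 < b' -> agree mu nu (exp_form (t1, t2))) ->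
    forall t2, a < t2 -> agree mu nu (exp_form (t1, t2)).
  move=> ab bb' Da ag t2 at2; rewrite -E2.
  apply: (agree_extend_ray mu nu (fun x => x.2) (fun x => expR (- (t1 * x.1))) a b b') => //.
  - exact: measurable_snd.
  - by move=> s sb; rewrite E2; exact: ag.
  - by move=> s as_; rewrite E2; apply: inu; apply: upD Da _ _ => //=; exact: ltW.
have step1 t1 t2 : q.2 < t2 < q.2 + r -> q.1 < t1 -> agree mu nu (exp_form (t1, t2)).
  move=> t2q; apply: (ray1 t2 q.1 q.1 (q.1 + r)) => //; first lra.
    by apply: upD Dq _ _ => //=; lra.
  by move=> s sq; have [] := agb (s, t2) => //=; lra.
have step2 t1 t2 : q.1 < t1 -> q.2 < t2 -> agree mu nu (exp_form (t1, t2)).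
  move=> t1q; apply: (ray2 t1 q.2 q.2 (q.2 + r)) => //; first lra.
    by apply: upD Dq _ _ => //=; lra.
  by move=> s sq; exact: step1.
have step3 t1 t2 : d.1 < t1 -> Num.max d.2 q.2 < t2 -> agree mu nu (exp_form (t1, t2)).
  move=> t1d; rewrite gt_max => /andP[t2d t2q].
  apply: (ray1 t2 d.1 (Num.max d.1 q.1) (Num.max d.1 q.1 + 1)) => //.
  - by rewrite le_max lexx.
  - lra.
  - by apply: upD Dd _ _ => //=; exact: ltW.
  - by move=> s; rewrite gt_max => /andP[/andP[_ ?] _]; exact: step2.
move=> [t1 t2] /= t1d.
apply: (ray2 t1 d.2 (Num.max d.2 q.2) (Num.max d.2 q.2 + 1)) => //.
- by rewrite le_max lexx.
- lra.
- by apply: upD Dd _ _ => //=; exact: ltW.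
- by move=> s /andP[? _]; exact: step3.
Qed.

(** * The domain of the transform, and uniqueness *)

Lemma laplaceE {R : realType} (mu : probability (plane R) R) (theta : R * R) :
  laplace mu theta = (\int[mu]_x (exp_form theta x)%:E)%E.
Proof. by rewrite /laplace unlock. Qed.

Lemma measurable_exp_form {R : realType} (theta : R * R) :
  measurable_fun setT (@exp_form R theta).
Proof.
apply: measurableT_comp => //; apply: measurable_funN.
by apply: measurable_funD; apply: measurable_funM.
Qed.

Lemma laplace_integrable {R : realType} (mu : probability (plane R) R)
    (theta : R * R) (l : R) :
  laplace mu theta = l%:E -> mu.-integrable setT (EFin \o exp_form theta).
Proof.
rewrite laplaceE => muE; apply/integrableP; split.
  by apply/measurable_EFinP; exact: measurable_exp_form.
under eq_integral do rewrite /= ger0_norm ?expR_ge0//.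
by rewrite muE ltry.
Qed.

(** P(t) - P(s) = (t1 - s1) (p1 + p12 s2) + (t2 - s2) (p2 + p12 t1), and both slopes are positive:
    for instance p2 (p1 + p12 s2) = (p1 p2 - p12) + p12 (1 + p2 s2). *)
Lemma mfg_domain_up {R : realType} (p1 p2 p12 : R) (s t : R * R) :
  0 < p1 -> 0 < p2 -> 0 < p12 -> p12 < p1 * p2 ->
  mfg_domain p1 p2 p12 s -> s.1 <= t.1 -> s.2 <= t.2 -> mfg_domain p1 p2 p12 t.
Proof.
rewrite /mfg_domain /affine2/= => p1_gt0 p2_gt0 p12_gt0 pp [Ps s1 s2] st1 st2.
have t1 : 0 < 1 + p1 * t.1.
  by apply: lt_le_trans s1 _; rewrite lerD2l ler_wpM2l// ltW.
have t2 : 0 < 1 + p2 * t.2.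
  by apply: lt_le_trans s2 _; rewrite lerD2l ler_wpM2l// ltW.
split=> //.
have h1 : 0 < p1 + p12 * s.2.
  rewrite -(pmulr_rgt0 _ p2_gt0).
  have := mulr_gt0 p12_gt0 s2; nra.
have h2 : 0 < p2 + p12 * t.1.
  rewrite -(pmulr_rgt0 _ p1_gt0).
  have := mulr_gt0 p12_gt0 t1; nra.
have : 0 <= (t.1 - s.1) * (p1 + p12 * s.2).
  by rewrite mulr_ge0 ?subr_ge0// ltW.
have : 0 <= (t.2 - s.2) * (p2 + p12 * t.1).
  by rewrite mulr_ge0 ?subr_ge0// ltW.
nra.
Qed.

(** Propagation reaches only points strictly beyond its corner, and all theta >= 0 including the
    axes are wanted, hence a corner with negative coordinates. There the affine part of P is 1 - 1/2
    - 1/3 > 0. *)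
Lemma mfg_domain_neg {R : realType} (p1 p2 p12 : R) :
  0 < p1 -> 0 < p2 -> 0 < p12 -> mfg_domain p1 p2 p12 (- (2 * p1)^-1, - (3 * p2)^-1).
Proof.
move=> p1_gt0 p2_gt0 p12_gt0.
have e1 : p1 * - (2 * p1)^-1 = - (1 / 2) by field; rewrite lt0r_neq0.
have e2 : p2 * - (3 * p2)^-1 = - (1 / 3) by field; rewrite lt0r_neq0.
have e3 : 0 < p12 * - (2 * p1)^-1 * - (3 * p2)^-1.
  by rewrite -mulrA mulrNN !mulr_gt0// invr_gt0 mulr_gt0.
by rewrite /mfg_domain /affine2/= e1 e2; split; lra.
Qed.

(** An interior point of [Th] supplies the initial box, possibly far from the origin; the transform
    of [nu], finite on the whole domain, carries the agreement from there to theta >= 0. *)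
Lemma is_multi_factor_gamma_unique {R : realType} (p1 p2 p12 lam lam1 lam2 : R)
    (mu nu : probability (plane R) R) :
  0 < p1 -> 0 < p2 -> 0 < p12 -> p12 < p1 * p2 ->
  (forall theta, mfg_domain p1 p2 p12 theta ->
    laplace nu theta = (mfg_formula p1 p2 p12 lam lam1 lam2 theta)%:E) ->
  nu (~` (`]0, +oo[ `*` `]0, +oo[)) = 0%E ->
  is_multi_factor_gamma p1 p2 p12 lam lam1 lam2 mu ->
  forall A : set (plane R), measurable A -> mu A = nu A.
Proof.
move=> p1_gt0 p2_gt0 p12_gt0 pp nuE nu0 [Th [[th intTh] ThD muE]].
have [e /= e0 The] : nbhs_ball th Th by exact/nbhs_ballP.
apply: upper_quadrant_measure_eq.
  by apply: le_lt_trans (probability_le1 mu measurableT) _; rewrite ltry.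
apply: agree_quadrant nu0 => s t s0 t0.
apply: (@agree_exp_form_extend R mu nu (mfg_domain p1 p2 p12)
  th (- (2 * p1)^-1, - (3 * p2)^-1) e e0 _ _ _ _ (s, t)).
- by move=> ? ?; exact: mfg_domain_up.
- by move=> z /nuE; exact: laplace_integrable.
- move=> z z1 z2.
  have Tz : Th z.
    by apply: The; split; rewrite /ball/= ltr_norml; lra.
  split; first exact: ThD.
  have Dz := ThD _ Tz.
  split; [exact: laplace_integrable (muE _ Tz)|exact: laplace_integrable (nuE _ Dz)|].
  by rewrite -!laplaceE muE// nuE.
- exact: mfg_domain_neg.
- by rewrite /= (lt_le_trans _ s0)// oppr_lt0 invr_gt0 mulr_gt0.
- by rewrite /= (lt_le_trans _ t0)// oppr_lt0 invr_gt0 mulr_gt0.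
Qed.

(** * The Gamma integral and the negative binomial series *)

Lemma preimage_scale_ocitv {R : realType} (u a b : R) : 0 < u ->
  (fun x : R => u * x) @^-1` `]a, b] = `]a / u, b / u]%classic.
Proof.
move=> u0; apply/seteqP; split=> x; rewrite /= !in_itv/=.
  by rewrite ltr_pdivrMr// ler_pdivlMr// ![x * u]mulrC.
by rewrite ltr_pdivrMr// ler_pdivlMr// ![x * u]mulrC.
Qed.

(** The image of Lebesgue measure under x -> u x, multiplied by u, agrees with Lebesgue measure on
    the intervals ]a, b], hence everywhere. *)
Lemma ge0_integral_scale {R : realType} (u : R) (f : R -> \bar R) :
  0 < u -> measurable_fun setT f -> (forall x, 0 <= f x)%E ->
  (u%:E * \int[@lebesgue_measure R]_(x in `]0%R, +oo[) f (u * x)%R =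
   \int[@lebesgue_measure R]_(x in `]0%R, +oo[) f x)%E.
Proof.
move=> u0 mf f0.
have mphi : measurable_fun setT (fun x : measurableTypeR R => u * x : measurableTypeR R).
  exact: measurable_funM.
rewrite (_ : `]0, +oo[%classic =
    (fun x : measurableTypeR R => u * x : measurableTypeR R) @^-1` `]0%R, +oo[); last first.
  by apply/seteqP; split=> x; rewrite /= !in_itv/= !andbT pmulr_rgt0.
rewrite -(ge0_integral_pushforward mphi _ _ _ _)//; last exact: measurable_funS mf.
have u0' := ltW u0.
rewrite -[u%:E]/((NngNum u0')%:num%:E) -ge0_integral_mscale//; last exact: measurable_funS mf.
rewrite (_ : _ @^-1` _ = `]0, +oo[%classic); last first.
  by apply/seteqP; split=> x; rewrite /= !in_itv/= !andbT pmulr_rgt0.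
apply: eq_measure_integral => /= A mA _.
apply/esym/lebesgue_measure_unique => //= _ [[a b]] _ <-.
rewrite /mscale/= /pushforward preimage_scale_ocitv//= !lebesgue_measure_itv/=.
rewrite !lte_fin ltr_pM2r ?invr_gt0//; case: ifPn => _; last by rewrite mule0.
by rewrite -!EFinD -EFinM -mulrBl mulrCA divff ?lt0r_neq0// mulr1.
Qed.

Lemma integral_expR_ray {R : realType} (a x : R) : 0 < x ->
  (\int[@lebesgue_measure R]_(w in `[a, +oo[) (expR (- (w * x)))%:E =
   (expR (- (a * x)) / x)%:E)%E.
Proof.
move=> x0.
have cF : continuous (fun w : R => expR (- (w * x))).
  move=> w; apply: (@continuous_comp _ _ _ (fun w : R => - (w * x)) expR);
    last exact: continuous_expR.
  by apply: continuousN; apply: continuousM => //; exact: cst_continuous.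
have dF (w : R) : is_derive w 1 (fun w => - (expR (- (w * x)) / x)) (expR (- (w * x))).
  apply: is_derive_eq.
  rewrite /GRing.scale/= !(mulr0, mulr1, add0r, addr0).
  by field; rewrite lt0r_neq0.
rewrite (@ge0_continuous_FTC2y _ _ (fun w => - (expR (- (w * x)) / x)) _ 0)//.
- by rewrite sub0e EFinN oppeK.
- exact: continuous_subspaceT.
- rewrite -oppr0 -(mul0r x^-1); apply: cvgN; apply: cvgM; last exact: cvg_cst.
  apply: (@cvg_comp _ _ _ (fun w => w * x) (fun z => expR (- z)) _
    (pinfty_nbhs R)); last exact: cvgr_expR.
  exact: gt0_cvgMly.
- apply: cvg_at_right_filter; apply: cvgN; apply: cvgM; last exact: cvg_cst.
  exact: cF.
- by move=> w _; rewrite derive1E; apply: derive_val.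
Qed.

Lemma integral_powR_ray {R : realType} (s : R) : 0 < s ->
  (\int[@lebesgue_measure R]_(w in `[1%R, +oo[) (w `^ (- s - 1))%:E = (s^-1)%:E)%E.
Proof.
move=> s0.
have dP (w a : R) : 0 < w -> is_derive w 1 ((@powR R) ^~ a) (a * w `^ (a - 1)).
  move=> w0; have wi : w \in `]0, +oo[ by rewrite in_itv/= w0.
  apply: DeriveDef; first exact: derivable_powR.
  by rewrite -derive1E powR_derive1.
have cP (w a : R) : 0 < w -> {for w, continuous ((@powR R) ^~ a)}.
  move=> w0; have [+ _] := dP w a w0.
  by move=> /derivable1_diffP/differentiable_continuous.
rewrite (@ge0_continuous_FTC2y _ _ (fun w => - s^-1 * w `^ (- s)) _ 0)//.
- by rewrite sub0e powR1 mulr1 EFinN oppeK.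
- by move=> x _; exact: powR_ge0.
- apply: continuous_in_subspaceT => w; rewrite inE/= in_itv/= andbT => w1.
  by apply: cP; exact: lt_le_trans w1.
- rewrite -(mulr0 (- s^-1)); apply: cvgM; first exact: cvg_cst.
  apply/cvgrPdist_le => e e0; near=> w.
  rewrite sub0r normrN ger0_norm ?powR_ge0// powRN.
  rewrite invf_ple ?posrE ?powR_gt0//.
  (* With 1 / e written as an s-th power, monotonicity reduces the claim to w >= (1 / e)^(1 / s),
     true for large w. *)
  have -> : e^-1 = ((e^-1) `^ s^-1) `^ s.
    by rewrite -powRrM mulVf ?lt0r_neq0// powRr1// invr_ge0 ltW.
  apply: ge0_ler_powR; rewrite ?nnegrE ?powR_ge0// ltW//.
- by move=> w w1; apply: derivableM => //; case: (dP w (- s) (lt_trans ltr01 w1)).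
- apply: cvgM; first exact: cvg_cst.
  by apply: cvg_at_right_filter; exact: cP.
- move=> w; rewrite in_itv/= andbT => w1.
  have dw := dP w (- s) (lt_trans ltr01 w1).
  have : is_derive w 1 (fun w => - s^-1 * w `^ (- s)) (w `^ (- s - 1)).
    apply: is_derive_eq; rewrite /GRing.scale/=.
    by field; rewrite lt0r_neq0.
  by move=> ?; rewrite derive1E; apply: derive_val.
Unshelve. all: by end_near. Qed.

Lemma integral_mul_indic {d} {T : measurableType d} {R : realType}
    (mu : {measure set T -> \bar R}) (D : set T) (h : T -> R) :
  (\int[mu]_(x in D) (h x)%:E = \int[mu]_x (h x * \1_D x)%:E)%E.
Proof.
rewrite integral_mkcond; apply: eq_integral => x _.
by rewrite patchE indicE; case: (x \in D); rewrite ?mulr1 ?mulr0.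
Qed.

(** Extended values let Tonelli's theorem and the functional equation be used before finiteness is
    known; the rate [u] will be the shifted Laplace variable. *)
Definition gamma_int {R : realType} (s u : R) : \bar R :=
  (\int[@lebesgue_measure R]_(x in `]0%R, +oo[) (x `^ (s - 1) * expR (- (u * x)))%:E)%E.

Lemma measurable_gamma_integrand {R : realType} (s u : R) :
  measurable_fun setT (fun x : R => x `^ (s - 1) * expR (- (u * x))).
Proof.
apply: measurable_funM => //; apply: measurableT_comp => //.
exact: measurable_funN.
Qed.

Lemma gamma_integrand_ge0 {R : realType} (s u x : R) :
  0 <= x `^ (s - 1) * expR (- (u * x)).
Proof. by rewrite mulr_ge0 ?powR_ge0 ?expR_ge0. Qed.

Lemma gamma_int_ge0 {R : realType} (s u : R) : (0 <= gamma_int s u)%E.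
Proof. by apply: integral_ge0 => x _; rewrite lee_fin gamma_integrand_ge0. Qed.

Lemma gamma_int_scale {R : realType} (s u : R) : 0 < u ->
  gamma_int s u = ((u `^ (- s))%:E * gamma_int s 1)%E.
Proof.
move=> u0; rewrite /gamma_int.
rewrite -(@ge0_integral_scale _ u (fun x => (x `^ (s - 1) * expR (- (1 * x)))%:E))//.
- rewrite muleA -ge0_integralZl//; last 3 first.
  + apply/measurable_EFinP; apply: measurable_funTS.
    apply: (measurableT_comp (measurable_gamma_integrand s 1)).
    exact: measurable_funM.
  + by move=> x _; rewrite lee_fin gamma_integrand_ge0.
  + by rewrite lee_fin mulr_ge0 ?powR_ge0 ?ltW.
  apply: eq_integral => x; rewrite inE/= in_itv/= andbT => x0.
  have uE : u `^ (- s) * u * u `^ (s - 1) = 1.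
    rewrite -{2}[u](powRr1 (ltW u0)) -!powRD ?(gt_eqF u0) ?implybT//.
    by rewrite (_ : - s + 1 + (s - 1) = 0) ?powRr0//; ring.
  by rewrite -EFinM powRM ?ltW// !mulrA uE !mul1r.
- by apply/measurable_EFinP; exact: measurable_gamma_integrand.
- by move=> x; rewrite lee_fin gamma_integrand_ge0.
Qed.

(** Tonelli for x^s expR (- w x) on x > 0, w >= 1. Integrating over w first leaves x^(s - 1) expR (-
    x); over x first, scaling gives w^(- s - 1) times the value at s + 1, and the integral of w^(- s
    - 1) is 1 / s. *)
Lemma gamma_int_succ {R : realType} (s : R) : 0 < s ->
  gamma_int (s + 1) 1 = (s%:E * gamma_int s 1)%E.
Proof.
move=> s0.
pose F (z : R * R) : \bar R :=
  (z.1 `^ s * expR (- (z.2 * z.1)) * \1_(`]0, +oo[) z.1 * \1_(`[1, +oo[) z.2)%:E.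
have mF : measurable_fun setT F.
  apply/measurable_EFinP; apply: measurable_funM; last first.
    by apply: measurableT_comp => //; exact: measurable_indic.
  apply: measurable_funM; last first.
    by apply: measurableT_comp => //; exact: measurable_indic.
  apply: measurable_funM; first exact: (measurableT_comp (measurable_powR _)).
  apply: measurableT_comp => //; apply: measurable_funN.
  exact: measurable_funM.
have F0 z : (0 <= F z)%E.
  by rewrite lee_fin !mulr_ge0 ?powR_ge0 ?expR_ge0// indicE.
have := @fubini_tonelli _ _ _ _ R (@lebesgue_measure R) (@lebesgue_measure R) F mF F0.
rewrite (_ : (\int[_]_x \int[_]_y _)%E = gamma_int s 1); last first.
  rewrite /gamma_int [RHS]integral_mul_indic; apply: eq_integral => x _.
  rewrite /F/= !indicE; have [x0|x0] := boolP (x \in `]0%R, +oo[%classic); last first.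
    by rewrite mulr0 integral0_eq// => y _; rewrite mulr0 mul0r.
  have {}x0 : 0 < x by move: x0; rewrite inE/= in_itv/= andbT.
  under eq_integral do rewrite mulr1.
  rewrite -integral_mul_indic.
  under eq_integral do rewrite EFinM.
  rewrite ge0_integralZl//.
  - rewrite integral_expR_ray// -EFinM mulr1; congr EFin.
    by rewrite mulrCA mulrC powRB ?(gt_eqF x0) ?implybT// powRr1 ?(ltW x0)// mulrAC.
  - apply/measurable_EFinP; apply: measurable_funTS.
    apply: measurableT_comp => //; apply: measurable_funN.
    exact: measurable_funM.
  - by rewrite lee_fin powR_ge0.
move=> ->.
rewrite (_ : (\int[_]_y _)%E = (\int[lebesgue_measure]_(w in `[1%R, +oo[)
  ((w `^ (- s - 1))%:E * gamma_int (s + 1) 1))%E); last first.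
  transitivity (\int[lebesgue_measure]_(w in `[1%R, +oo[) gamma_int (s + 1) w)%E.
    rewrite [RHS]integral_mkcond; apply: eq_integral => w _.
    rewrite patchE /F/= [\1__ w]indicE; case: ifPn => w1; last first.
      by rewrite integral0_eq// => x _; rewrite mulr0.
    rewrite /gamma_int [RHS]integral_mul_indic addrK.
    by apply: eq_integral => x _; rewrite mulr1.
  apply: eq_integral => w; rewrite inE/= in_itv/= andbT => w1.
  by rewrite gamma_int_scale ?(lt_le_trans ltr01)// opprD.
rewrite ge0_integralZr//.
- rewrite integral_powR_ray// muleA -EFinM divff ?lt0r_neq0// mul1e//.
- exact/measurable_EFinP/measurable_funTS.
- by move=> w _; rewrite lee_fin powR_ge0.
- exact: gamma_int_ge0.
Qed.

Lemma gamma_int11 {R : realType} : gamma_int (1 : R) 1 = 1%E.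
Proof.
transitivity (\int[@lebesgue_measure R]_(w in `[0%R, +oo[) (expR (- (w * 1)))%:E)%E.
  rewrite -integral_itv_obnd_cbnd; last first.
    apply/measurable_EFinP; apply: measurable_funTS.
    apply: measurableT_comp => //; apply: measurable_funN.
    exact: measurable_funM.
  by apply: eq_integral => x _; rewrite subrr powRr0 !mul1r mulr1.
by rewrite integral_expR_ray// mul0r oppr0 expR0 divr1.
Qed.

Lemma gamma_intS_fin_num {R : realType} (n : nat) :
  gamma_int (n.+1%:R : R) 1 \is a fin_num.
Proof.
elim: n => [|n IHn]; first by rewrite gamma_int11.
by rewrite -natr1 gamma_int_succ// fin_numM.
Qed.

(** The functional equation passes from s to s + 1, where x^s <= 1 + x^n for a natural n >= s;
    integer arguments follow by recursion from [gamma_int11]. *)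
Lemma gamma_int_fin_num {R : realType} (s : R) : 0 < s ->
  gamma_int s 1 \is a fin_num.
Proof.
move=> s0.
suff : gamma_int (s + 1) 1 \is a fin_num.
  rewrite gamma_int_succ// => h.
  have -> : gamma_int s 1 = ((s^-1)%:E * (s%:E * gamma_int s 1))%E.
    by rewrite muleA -EFinM mulVf ?lt0r_neq0// mul1e.
  by rewrite fin_numM.
pose n := (Num.truncn s).+1.
have sn : s <= n%:R by have /andP[_ /ltW] := truncn_itv (ltW s0).
rewrite ge0_fin_numE ?gamma_int_ge0//.
have fin2 : (gamma_int (1 : R) 1 + gamma_int (n.+1%:R : R) 1)%E \is a fin_num.
  by rewrite fin_numD gamma_int11 gamma_intS_fin_num.
apply: le_lt_trans (_ : _ <= gamma_int (1 : R) 1 + gamma_int (n.+1%:R : R) 1)%E _; last first.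
  by rewrite -ge0_fin_numE// adde_ge0 ?gamma_int_ge0.
rewrite /gamma_int -ge0_integralD//; last 4 first.
- by move=> x _; rewrite lee_fin gamma_integrand_ge0.
- by apply/measurable_EFinP/measurable_funTS; exact: measurable_gamma_integrand.
- by move=> x _; rewrite lee_fin gamma_integrand_ge0.
- by apply/measurable_EFinP/measurable_funTS; exact: measurable_gamma_integrand.
apply: ge0_le_integral => //.
- by move=> x _; rewrite lee_fin gamma_integrand_ge0.
- by apply/measurable_EFinP/measurable_funTS; exact: measurable_gamma_integrand.
- by apply: emeasurable_funD; apply/measurable_EFinP/measurable_funTS;
    exact: measurable_gamma_integrand.
move=> x; rewrite /= in_itv/= andbT => x0.
rewrite lee_fin -mulrDl ler_wpM2r ?expR_ge0// addrK subrr powRr0 -natr1 addrK.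
have [x1|x1] := leP x 1.
  rewrite ler_wpDr ?powR_ge0//.
  by apply: le_trans (ger_powR _ (ltW s0)) _; rewrite ?x0// powRr0.
by rewrite ler_wpDl// ler_powR// ltW.
Qed.

(** A zero integral would make the positive integrand vanish almost everywhere, so the half-line
    would be a null set. *)
Lemma gamma_int_gt0 {R : realType} (s : R) : (0 < gamma_int s 1)%E.
Proof.
rewrite lt0e gamma_int_ge0 andbT; apply/eqP => int0.
have mg : measurable_fun (`]0%R, +oo[ : set (measurableTypeR R))
    (EFin \o (fun x : R => x `^ (s - 1) * expR (- (1 * x)))).
  by apply/measurable_EFinP/measurable_funTS; exact: measurable_gamma_integrand.
have mD : measurable (`]0%R, +oo[ : set (measurableTypeR R)) by exact: measurable_itv.
have [+ _] := @ae_eq_integral_abs _ _ R (@lebesgue_measure R) _ mD _ mg.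
case.
  rewrite -[RHS]int0; apply: eq_integral => x _.
  by rewrite gee0_abs// lee_fin gamma_integrand_ge0.
move=> N [mN N0 subN].
have : (@lebesgue_measure R `]0%R, +oo[ <= lebesgue_measure N)%E.
  apply: le_measure; rewrite ?inE// => x x0; apply: subN => /= /(_ x0) /eqP.
  have {}x0 : 0 < x by move: x0; rewrite /= in_itv/= andbT.
  by rewrite eqe gt_eqF// mulr_gt0 ?powR_gt0 ?expR_gt0.
by rewrite N0 lebesgue_measure_itv/= ltry/= leNgt ltry.
Qed.

Lemma GammaE {R : realType} (s : R) : Gamma s = fine (gamma_int s 1).
Proof.
congr fine; apply: eq_integral => x _; by rewrite mul1r.
Qed.

Lemma Gamma_gt0 {R : realType} (s : R) : 0 < s -> 0 < Gamma s.
Proof.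
move=> s0; rewrite GammaE fine_gt0// gamma_int_gt0/=.
by rewrite -ge0_fin_numE ?gamma_int_ge0// gamma_int_fin_num.
Qed.

(** * Pochhammer symbols and the binomial series *)

Lemma pochhammer_gt0 {R : realType} (a : R) (m : nat) : 0 < a -> 0 < pochhammer a m.
Proof.
by move=> a0; elim: m => //= m IHm; rewrite mulr_gt0// ltr_wpDr.
Qed.

Lemma pochhammer_ge0 {R : realType} (a : R) (m : nat) : 0 <= a -> 0 <= pochhammer a m.
Proof.
by move=> a0; elim: m => //= m IHm; rewrite mulr_ge0// addr_ge0.
Qed.

Lemma gamma_int_pochhammer {R : realType} (s u : R) (m : nat) :
  0 < s -> 0 < u ->
  gamma_int (s + m%:R) u = (pochhammer s m * Gamma s * u `^ (- (s + m%:R)))%:E.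
Proof.
move=> s0 u0; rewrite gamma_int_scale// muleC EFinM; congr (_ * _)%E.
elim: m => [|m IHm] /=.
  by rewrite addr0 mul1r GammaE fineK// gamma_int_fin_num.
by rewrite -natr1 addrA gamma_int_succ ?ltr_wpDr// IHm -EFinM mulrA.
Qed.

Lemma nneseries_expR {R : realType} (y : R) :
  (\sum_(0 <= m <oo) (y ^+ m / m`!%:R)%:E = (expR y)%:E)%E.
Proof.
apply/cvg_lim => //; under eq_fun do rewrite sumEFin.
by apply/cvg_EFin; [exact: nearW|exact: is_cvg_series_exp_coeff].
Qed.

(** For a > 0, the integral of x^(a - 1) expR (- (1 - z) x) is Gamma(a) (1 - z)^(-a); expanding expR
    (z x) under it gives the series, since Gamma(a + m) = (a)_m Gamma(a). *)
Lemma negative_binomial_series {R : realType} (a z : R) :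
  0 <= a -> 0 <= z < 1 ->
  (\sum_(0 <= m <oo) (pochhammer a m * z ^+ m / m`!%:R)%:E = ((1 - z) `^ (- a))%:E)%E.
Proof.
rewrite le_eqVlt => /orP[/eqP <-|a0] /andP[z0 z1].
  (* The case a = 0, met when lam1 or lam2 equals lam, has a divergent Gamma integral. Only the term
     m = 0 survives, as (0)_(m + 1) contains the factor 0. *)
  rewrite oppr0 powRr0 (@nneseries_split _ _ 0 1)//; last first.
    by move=> k _; rewrite lee_fin divr_ge0// mulr_ge0 ?pochhammer_ge0 ?exprn_ge0.
  rewrite add0n big_nat1 eseries0 ?adde0 ?expr0 ?fact0 ?mulr1 ?divr1//.
  move=> [//|m] _ _; rewrite (_ : pochhammer 0 m.+1 = 0) ?mul0r//.
  by elim: m => [|m IHm]; rewrite /= ?addr0 ?mul0r// -/(pochhammer 0 m.+1) IHm mulr0.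
have G0 := Gamma_gt0 _ a0.
have mD : measurable (`]0%R, +oo[ : set (measurableTypeR R)) by exact: measurable_itv.
have E : gamma_int a (1 - z) =
    (\sum_(0 <= m <oo) ((z ^+ m / m`!%:R)%:E * gamma_int (a + m%:R) 1))%E.
  rewrite /gamma_int.
  under [RHS]eq_eseriesr => m _.
    rewrite -ge0_integralZl//; last 3 first.
    - by apply/measurable_EFinP/measurable_funTS; exact: measurable_gamma_integrand.
    - by move=> x _; rewrite lee_fin gamma_integrand_ge0.
    - by rewrite lee_fin divr_ge0// exprn_ge0.
    over.
  rewrite -integral_nneseries//; last 2 first.
  - move=> m; apply: measurable_funeM; apply/measurable_EFinP/measurable_funTS.
    exact: measurable_gamma_integrand.
  - move=> m x _; rewrite mule_ge0// lee_fin ?gamma_integrand_ge0//.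
    by rewrite divr_ge0// exprn_ge0.
  apply: eq_integral => x; rewrite inE/= in_itv/= andbT => x0.
  transitivity ((x `^ (a - 1) * expR (- x))%:E * \sum_(0 <= m <oo) ((z * x) ^+ m / m`!%:R)%:E)%E.
    rewrite nneseries_expR -EFinM -mulrA -expRD; congr (_ * expR _)%:E; ring.
  rewrite -nneseriesZl//; last first.
    by move=> m _; rewrite lee_fin divr_ge0// exprn_ge0// mulr_ge0// ltW.
  apply: eq_eseriesr => m _; rewrite -!EFinM; congr EFin.
  rewrite (_ : a + m%:R - 1 = a - 1 + m%:R); last by ring.
  have -> : x `^ (a - 1 + m%:R) = x `^ (a - 1) * x ^+ m.
    by rewrite powRD ?(gt_eqF x0) ?implybT// powR_mulrn// ltW.
  rewrite exprMn mul1r; ring.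
have E0 : gamma_int a (1 - z) = (Gamma a * (1 - z) `^ (- a))%:E.
  by have := gamma_int_pochhammer a (1 - z) 0 a0; rewrite addr0 subr_gt0 mul1r; exact.
have Em m : ((z ^+ m / m`!%:R)%:E * gamma_int (a + m%:R) 1 =
    (Gamma a)%:E * (pochhammer a m * z ^+ m / m`!%:R)%:E)%E.
  by rewrite gamma_int_pochhammer// powR1 -!EFinM; congr EFin; ring.
rewrite E0 (eq_eseriesr (fun m _ => Em m)) nneseriesZl in E; last first.
  by move=> m _; rewrite lee_fin divr_ge0// mulr_ge0 ?exprn_ge0// pochhammer_ge0// ltW.
have cancel (y : \bar R) : y = ((Gamma a)^-1%:E * ((Gamma a)%:E * y))%E.
  by rewrite muleA -EFinM mulVf ?lt0r_neq0// mul1e.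
by rewrite [LHS]cancel -E -EFinM mulrA mulVf ?mul1r// lt0r_neq0.
Qed.

(** * Probabilities given by a density *)

(* [mf] and [f0] do not occur in the body: they carry the measure structure. *)
Definition density_measure {d} {T : measurableType d} {R : realType}
    (mu : {measure set T -> \bar R}) (f : T -> R)
    (mf : measurable_fun setT f) (f0 : forall x, 0 <= f x) : set T -> \bar R :=
  fun A => (\int[mu]_(x in A) (f x)%:E)%E.

Lemma density_measure0 {d} {T : measurableType d} {R : realType}
    (mu : {measure set T -> \bar R}) (f : T -> R)
    (mf : measurable_fun setT f) (f0 : forall x, 0 <= f x) :
  density_measure mu f mf f0 set0 = 0%E.
Proof. exact: integral_set0. Qed.

Lemma density_measure_ge0 {d} {T : measurableType d} {R : realType}
    (mu : {measure set T -> \bar R}) (f : T -> R)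
    (mf : measurable_fun setT f) (f0 : forall x, 0 <= f x) (A : set T) :
  (0 <= density_measure mu f mf f0 A)%E.
Proof. by apply: integral_ge0 => x _; rewrite lee_fin. Qed.

Lemma density_measure_sigma_additive {d} {T : measurableType d} {R : realType}
    (mu : {measure set T -> \bar R}) (f : T -> R)
    (mf : measurable_fun setT f) (f0 : forall x, 0 <= f x) :
  semi_sigma_additive (density_measure mu f mf f0).
Proof.
move=> /= F mF tF mUF; rewrite /density_measure ge0_integral_bigcup//.
- by apply: is_cvg_ereal_nneg_natsum_cond => n _ _; exact: density_measure_ge0.
- by apply/measurable_EFinP; exact: measurable_funTS.
- by move=> x _; rewrite lee_fin.
Qed.

HB.instance Definition _ {d} {T : measurableType d} {R : realType}
    (mu : {measure set T -> \bar R}) (f : T -> R)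
    (mf : measurable_fun setT f) (f0 : forall x, 0 <= f x) :=
  isMeasure.Build _ _ _ (density_measure mu f mf f0)
    (density_measure0 mu f mf f0) (density_measure_ge0 mu f mf f0)
    (density_measure_sigma_additive mu f mf f0).

Lemma probability_of_density {d} {T : measurableType d} {R : realType}
    (mu : {measure set T -> \bar R}) (f : T -> R) :
  measurable_fun setT f -> (forall x, 0 <= f x) ->
  (\int[mu]_x (f x)%:E = 1)%E ->
  exists P : probability T R,
    forall A, P A = (\int[mu]_(x in A) (f x)%:E)%E.
Proof.
move=> mf f0 f1.
pose m : {measure set T -> \bar R} := density_measure mu f mf f0.
have m1 : m setT = 1%E by [].
pose prob := Measure_isProbability.Build _ _ _ m m1.
by exists (HB.pack_for (probability T R) (Measure.sort m) prob).
Qed.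

(** The Radon-Nikodym derivative of [P] and [f] have the same integral over every measurable set, so
    they agree almost everywhere, and the change of variables for the former carries over to [f]. *)
Lemma ge0_integral_density {d} {T : measurableType d} {R : realType}
    (mu : {measure set T -> \bar R}) (P : probability T R)
    (f : T -> R) (h : T -> \bar R) :
  sigma_finite setT mu ->
  measurable_fun setT f -> (forall x, 0 <= f x) ->
  (forall A, measurable A -> P A = (\int[mu]_(x in A) (f x)%:E)%E) ->
  measurable_fun setT h -> (forall x, 0 <= h x)%E ->
  (\int[P]_x h x = \int[mu]_x (h x * (f x)%:E))%E.
Proof.
(* Destructing [mu] lets [HB.pack_for] reuse its measure structure. *)
case: mu => m m_measure; set mu := Measure.Pack m_measure.
move=> mu_sigma_finite mf f0 PE mh h0.
pose sf := Measure_isSigmaFinite.Build _ _ _ mu mu_sigma_finite.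
pose nu := HB.pack_for {sigma_finite_measure set T -> \bar R} m m_measure sf.
have Pnu : P `<< nu.
  apply/null_content_dominatesP => A mA nuA0; rewrite PE//.
  by apply: null_set_integral => //; apply/measurable_EFinP; exact: measurable_funTS.
have iF : mu.-integrable setT (EFin \o f).
  apply/integrableP; split; first exact/measurable_EFinP.
  under eq_integral do rewrite /= ger0_norm//.
  by rewrite -PE// probability_setT ltry.
rewrite -(Radon_Nikodym_SigmaFinite.change_of_variables Pnu)//.
have mRN := measurable_int _ (Radon_Nikodym_SigmaFinite.f_integrable Pnu).
apply: (@ae_eq_integral _ _ _ mu) => //.
- exact: emeasurable_funM.
- by apply: emeasurable_funM => //; exact/measurable_EFinP.
apply: ae_eqe_mul2l; apply: integral_ae_eq => //.
- exact: (Radon_Nikodym_SigmaFinite.f_integrable Pnu).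
- exact/measurable_EFinP.
- move=> A _ mA; rewrite -PE//.
  exact/esym/(Radon_Nikodym_SigmaFinite.f_integral Pnu).
Qed.

Lemma sigma_finite_lebesgue_plane {R : realType} :
  sigma_finite setT (@lebesgue_measure R \x @lebesgue_measure R)%E.
Proof.
pose I (n : nat) : set (measurableTypeR R) := `[- n%:R, n%:R]%classic.
have mI n : measurable (I n) by exact: measurable_itv.
exists (fun n => I n `*` I n).
  apply/esym/seteqP; split=> // -[x y] _.
  pose n := maxn (Num.truncn `|x|).+1 (Num.truncn `|y|).+1.
  have In (z : R) : ((Num.truncn `|z|).+1 <= n)%N -> I n z.
    move=> zn; rewrite /I/= in_itv/= -ler_norml ltW//.
    have /andP[_ /lt_le_trans] := truncn_itv (normr_ge0 z); apply.
    by rewrite ler_nat.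
  by exists n => //; split; apply: In; rewrite ?leq_maxl ?leq_maxr.
move=> n; split; first exact: measurableX.
have Ifin : (@lebesgue_measure R (I n) < +oo)%E.
  by rewrite /I lebesgue_measure_itv/=; case: ifP => // _; rewrite -EFinD ltry.
by rewrite product_measure1E// lte_mul_pinfty// ge0_fin_numE.
Qed.

Lemma ge0_integral_prodM {R : realType} (f g : R -> R) :
  measurable_fun setT f -> measurable_fun setT g ->
  (forall x, 0 <= f x) -> (forall x, 0 <= g x) ->
  (\int[@lebesgue_measure R \x @lebesgue_measure R]_z (f z.1 * g z.2)%:E =
   (\int[@lebesgue_measure R]_x (f x)%:E) * \int[@lebesgue_measure R]_x (g x)%:E)%E.
Proof.
move=> mf mg f0 g0.
rewrite (@fubini_tonelli1 _ _ _ _ R lebesgue_measure lebesgue_measure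
  (fun z => (f z.1 * g z.2)%:E)).
- rewrite -ge0_integralZr//.
  + apply: eq_integral => x _; rewrite -ge0_integralZl//.
    * exact/measurable_EFinP.
    * by move=> y _; rewrite lee_fin.
    * by rewrite lee_fin.
  + exact/measurable_EFinP.
  + by move=> x _; rewrite lee_fin.
  + by apply: integral_ge0 => x _; rewrite lee_fin.
- apply/measurable_EFinP; apply: measurable_funM.
  + exact: (measurableT_comp mf measurable_fst).
  + exact: (measurableT_comp mg measurable_snd).
- by move=> z; rewrite lee_fin mulr_ge0.
Qed.

(** * The Laplace transform of the F_I density *)

Local Notation quadrant R := (`]0%R, +oo[ `*` `]0%R, +oo[ : set (plane R)).

(** The constants stay free here. In the theorem a and b are lam1 - lam and lam2 - lam, l is lam, A
    and B are c p12 / p1 and c p12 / p2, and (s, t) is (p2 / p12, p1 / p12). *)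
Definition FI_density_term {R : realType} (k a b l A B c s t : R)
    (m1 m2 m3 : nat) (x : plane R) : R :=
  k * x.1 `^ (a + l - 1) * x.2 `^ (b + l - 1) * expR (- (s * x.1 + t * x.2))
  * FI_term a b l (A * x.1) (B * x.2) (c * x.1 * x.2) m1 m2 m3
  * \1_(quadrant R) x.

Lemma indic_quadrant {R : realType} (x : plane R) :
  \1_(quadrant R) x = \1_(`]0, +oo[) x.1 * \1_(`]0, +oo[) x.2 :> R.
Proof.
rewrite !indicE -natrM mulnb; congr (_%:R); congr nat_of_bool.
by apply/idP/andP; rewrite !inE /=.
Qed.

Lemma FI_term_ge0 {R : realType} (a b l z1 z2 z3 : R) (m1 m2 m3 : nat) :
  0 <= a -> 0 <= b -> 0 <= l -> 0 <= z1 -> 0 <= z2 -> 0 <= z3 ->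
  0 <= FI_term a b l z1 z2 z3 m1 m2 m3.
Proof.
move=> a0 b0 l0 z10 z20 z30; rewrite /FI_term.
by rewrite !mulr_ge0 ?invr_ge0 ?exprn_ge0 ?mulr_ge0 ?pochhammer_ge0 ?addr_ge0.
Qed.

Lemma FI_density_term_ge0 {R : realType} (k a b l A B c s t : R) (m1 m2 m3 : nat)
    (x : plane R) :
  0 <= k -> 0 <= a -> 0 <= b -> 0 <= l -> 0 <= A -> 0 <= B -> 0 <= c ->
  0 <= FI_density_term k a b l A B c s t m1 m2 m3 x.
Proof.
move=> k0 a0 b0 l0 A0 B0 c0; rewrite /FI_density_term indicE.
have [|_] := boolP (x \in _); last by rewrite mulr0.
rewrite inE /= !in_itv/= !andbT => -[x1 x2].
rewrite mulr1 mulr_ge0 ?FI_term_ge0 ?mulr_ge0 ?powR_ge0 ?expR_ge0// ltW//.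
Qed.

(** A term separates into one Gamma integrand per coordinate; m3 enters both exponents because the
    third argument of F_I is c x1 x2. *)
Lemma FI_density_termE {R : realType} (k a b l A B c s t : R) (th : R * R)
    (m1 m2 m3 : nat) (x : plane R) :
  exp_form th x * FI_density_term k a b l A B c s t m1 m2 m3 x =
  k * FI_term a b l A B c m1 m2 m3 *
  ((x.1 `^ (a + l + (m1 + m3)%:R - 1) * expR (- ((th.1 + s) * x.1)) * \1_(`]0, +oo[) x.1) *
   (x.2 `^ (b + l + (m2 + m3)%:R - 1) * expR (- ((th.2 + t) * x.2)) * \1_(`]0, +oo[) x.2)).
Proof.
rewrite /FI_density_term indic_quadrant !indicE.
(* Outside the open quadrant both sides vanish, so the power laws are applied to positive bases. *)
have [x1|_] := boolP (x.1 \in _); last by rewrite !(mulr0, mul0r).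
have [x2|_] := boolP (x.2 \in _); last by rewrite !(mulr0, mul0r).
move: x1 x2; rewrite !inE /= !in_itv/= !andbT => x1 x2; rewrite !mulr1.
have powD (y r : R) (n : nat) : 0 < y -> y `^ (r + n%:R - 1) = y `^ (r - 1) * y ^+ n.
  move=> y0; rewrite addrAC (@powRD _ y (r - 1)) ?(gt_eqF y0) ?implybT//.
  by rewrite powR_mulrn// ltW.
rewrite !powD//.
have -> : expR (- ((th.1 + s) * x.1)) = expR (- (th.1 * x.1)) * expR (- (s * x.1)).
  by rewrite -expRD; congr expR; ring.
have -> : expR (- ((th.2 + t) * x.2)) = expR (- (th.2 * x.2)) * expR (- (t * x.2)).
  by rewrite -expRD; congr expR; ring.
rewrite /exp_form !opprD !expRD /FI_term !exprMn !exprD.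
ring.
Qed.

Lemma measurable_FI_density_term {R : realType} (k a b l A B c s t : R)
    (m1 m2 m3 : nat) :
  measurable_fun setT (FI_density_term k a b l A B c s t m1 m2 m3).
Proof.
rewrite /FI_density_term /FI_term; do !apply: measurable_funM => //.
- exact: (measurableT_comp (measurable_powR _) measurable_fst).
- exact: (measurableT_comp (measurable_powR _) measurable_snd).
- exact: (measurable_exp_form (s, t)).
- by apply: measurable_funX; apply: measurable_funM.
- by apply: measurable_funX; apply: measurable_funM.
- by apply: measurable_funX; apply: measurable_funM => //; apply: measurable_funM.
- by apply: measurable_indic; apply: measurableX; exact: measurable_itv.
Qed.

(** Cancelling the denominators of F_I, which alone couple the three indices, leaves a product of
    one factor per index. *)
Lemma integral_FI_density_term {R : realType} (k a b l A B c s t : R) (th : R * R)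
    (m1 m2 m3 : nat) :
  0 <= a -> 0 <= b -> 0 < l -> 0 < th.1 + s -> 0 < th.2 + t ->
  0 <= k -> 0 <= A -> 0 <= B -> 0 <= c ->
  let u := th.1 + s in let v := th.2 + t in
  (\int[@lebesgue_measure R \x @lebesgue_measure R]_x
     (exp_form th x * FI_density_term k a b l A B c s t m1 m2 m3 x)%:E =
   (k * Gamma (a + l) * Gamma (b + l) * u `^ (- (a + l)) * v `^ (- (b + l)) *
    ((pochhammer a m1 * (A / u) ^+ m1 / m1`!%:R) *
     ((pochhammer b m2 * (B / v) ^+ m2 / m2`!%:R) *
      (pochhammer l m3 * (c / (u * v)) ^+ m3 / m3`!%:R))))%:E)%E.
Proof.
move=> a0 b0 l0 u0 v0 k0 A0 B0 c0 u v.
have al0 : 0 < a + l by rewrite ltr_wpDl.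
have bl0 : 0 < b + l by rewrite ltr_wpDl.
pose f (y : R) := y `^ (a + l + (m1 + m3)%:R - 1) * expR (- (u * y)) * \1_(`]0, +oo[) y.
pose g (y : R) := y `^ (b + l + (m2 + m3)%:R - 1) * expR (- (v * y)) * \1_(`]0, +oo[) y.
have mf : measurable_fun setT f.
  apply: measurable_funM; first exact: measurable_gamma_integrand.
  exact: measurable_indic.
have mg : measurable_fun setT g.
  apply: measurable_funM; first exact: measurable_gamma_integrand.
  exact: measurable_indic.
have f0 y : 0 <= f y by rewrite mulr_ge0 ?gamma_integrand_ge0// indicE.
have g0 y : 0 <= g y by rewrite mulr_ge0 ?gamma_integrand_ge0// indicE.
under eq_integral do rewrite FI_density_termE EFinM.
rewrite ge0_integralZl//; last 3 first.
- apply/measurable_EFinP; apply: measurable_funM.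
    exact: (measurableT_comp mf measurable_fst).
  exact: (measurableT_comp mg measurable_snd).
- by move=> x _; rewrite lee_fin; apply: mulr_ge0; [exact: f0|exact: g0].
- by rewrite lee_fin mulr_ge0// FI_term_ge0// ltW.
rewrite (ge0_integral_prodM f g)// /f /g -!integral_mul_indic.
rewrite -[X in (_ * (X * _))%E]/(gamma_int _ _) -[X in (_ * (_ * X))%E]/(gamma_int _ _).
rewrite !gamma_int_pochhammer// -!EFinM; congr EFin.
have powDN (y r : R) (n : nat) : 0 < y -> y `^ (- (r + n%:R)) = y `^ (- r) / y ^+ n.
  move=> y0; rewrite opprD powRD ?(gt_eqF y0) ?implybT//.
  by rewrite powR_invn// ltW.
rewrite !powDN// /FI_term !exprMn !exprVn exprMn !exprD.
have fact0 m : m`!%:R != 0 :> R by rewrite pnatr_eq0 -lt0n fact_gt0.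
have P1 : pochhammer (a + l) (m1 + m3) != 0 by rewrite lt0r_neq0// pochhammer_gt0.
have P2 : pochhammer (b + l) (m2 + m3) != 0 by rewrite lt0r_neq0// pochhammer_gt0.
have un0 : u != 0 by rewrite lt0r_neq0.
have vn0 : v != 0 by rewrite lt0r_neq0.
field.
by rewrite !fact0 P1 P2 !expf_neq0.
Qed.

(** Extended values allow sums and integrals to be exchanged before any convergence of F_I is
    established. *)
Definition FI_density_series {R : realType} (k a b l A B c s t : R)
    (x : plane R) : \bar R :=
  (\sum_(0 <= m1 <oo) \sum_(0 <= m2 <oo) \sum_(0 <= m3 <oo)
    (FI_density_term k a b l A B c s t m1 m2 m3 x)%:E)%E.

(** * Iterated triple series with nonnegative terms *)

Lemma nneseries3Zl {R : realType} (r : R) (f : nat -> nat -> nat -> \bar R) :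
  (forall m1 m2 m3, 0 <= f m1 m2 m3)%E ->
  (\sum_(0 <= m1 <oo) \sum_(0 <= m2 <oo) \sum_(0 <= m3 <oo) (r%:E * f m1 m2 m3) =
   r%:E * \sum_(0 <= m1 <oo) \sum_(0 <= m2 <oo) \sum_(0 <= m3 <oo) f m1 m2 m3)%E.
Proof.
move=> f0; rewrite -nneseriesZl; last first.
  by move=> m1 _; apply: nneseries_ge0 => m2 _ _; apply: nneseries_ge0.
apply: eq_eseriesr => m1 _; rewrite -nneseriesZl; last first.
  by move=> m2 _; apply: nneseries_ge0.
by apply: eq_eseriesr => m2 _; rewrite -nneseriesZl.
Qed.

Lemma measurable_nneseries3 {d} {T : measurableType d} {R : realType}
    (f : nat -> nat -> nat -> T -> \bar R) :
  (forall m1 m2 m3, measurable_fun setT (f m1 m2 m3)) ->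
  (forall m1 m2 m3 x, 0 <= f m1 m2 m3 x)%E ->
  measurable_fun setT (fun x =>
    \sum_(0 <= m1 <oo) \sum_(0 <= m2 <oo) \sum_(0 <= m3 <oo) f m1 m2 m3 x)%E.
Proof.
move=> mf f0.
have f0' m1 m2 x : (0 <= \sum_(0 <= m3 <oo) f m1 m2 m3 x)%E by exact: nneseries_ge0.
have f0'' m1 x : (0 <= \sum_(0 <= m2 <oo) \sum_(0 <= m3 <oo) f m1 m2 m3 x)%E.
  exact: nneseries_ge0.
apply: ge0_emeasurable_sum => // m1 _.
apply: ge0_emeasurable_sum => // m2 _.
exact: ge0_emeasurable_sum.
Qed.

Lemma integral_nneseries3 {d} {T : measurableType d} {R : realType}
    (mu : {measure set T -> \bar R}) (f : nat -> nat -> nat -> T -> \bar R) :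
  (forall m1 m2 m3, measurable_fun setT (f m1 m2 m3)) ->
  (forall m1 m2 m3 x, 0 <= f m1 m2 m3 x)%E ->
  (\int[mu]_x (\sum_(0 <= m1 <oo) \sum_(0 <= m2 <oo) \sum_(0 <= m3 <oo) f m1 m2 m3 x) =
   \sum_(0 <= m1 <oo) \sum_(0 <= m2 <oo) \sum_(0 <= m3 <oo) \int[mu]_x f m1 m2 m3 x)%E.
Proof.
move=> mf f0.
have f0' m1 m2 x : (0 <= \sum_(0 <= m3 <oo) f m1 m2 m3 x)%E by exact: nneseries_ge0.
have f0'' m1 x : (0 <= \sum_(0 <= m2 <oo) \sum_(0 <= m3 <oo) f m1 m2 m3 x)%E.
  exact: nneseries_ge0.
rewrite integral_nneseries//; last first.
  move=> m1; apply: ge0_emeasurable_sum => // m2 _.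
  exact: ge0_emeasurable_sum.
apply: eq_eseriesr => m1 _; rewrite integral_nneseries//; last first.
  by move=> m2; exact: ge0_emeasurable_sum.
by apply: eq_eseriesr => m2 _; rewrite integral_nneseries.
Qed.

Lemma nneseries3M {R : realType} (f g h : nat -> R) (sf sg sh : R) :
  (forall m, 0 <= f m) -> (forall m, 0 <= g m) -> (forall m, 0 <= h m) ->
  (\sum_(0 <= m <oo) (f m)%:E = sf%:E)%E ->
  (\sum_(0 <= m <oo) (g m)%:E = sg%:E)%E ->
  (\sum_(0 <= m <oo) (h m)%:E = sh%:E)%E ->
  (\sum_(0 <= m1 <oo) \sum_(0 <= m2 <oo) \sum_(0 <= m3 <oo)
    (f m1 * (g m2 * h m3))%:E = (sf * (sg * sh))%:E)%E.
Proof.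
move=> f0 g0 h0 fE gE hE.
have hE' m1 m2 : (\sum_(0 <= m3 <oo) (f m1 * (g m2 * h m3))%:E = (f m1 * (g m2 * sh))%:E)%E.
  under eq_eseriesr do rewrite mulrA EFinM.
  rewrite nneseriesZl; last by move=> m _; rewrite lee_fin.
  by rewrite hE -EFinM mulrA.
have gE' m1 : (\sum_(0 <= m2 <oo) \sum_(0 <= m3 <oo) (f m1 * (g m2 * h m3))%:E =
    (f m1 * (sg * sh))%:E)%E.
  transitivity (\sum_(0 <= m2 <oo) ((f m1 * sh)%:E * (g m2)%:E))%E.
    by apply: eq_eseriesr => m2 _; rewrite hE' mulrCA mulrC EFinM.
  rewrite nneseriesZl; last by move=> m _; rewrite lee_fin.
  by rewrite gE -EFinM -mulrA [sh * _]mulrC.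
transitivity (\sum_(0 <= m1 <oo) ((sg * sh)%:E * (f m1)%:E))%E.
  by apply: eq_eseriesr => m1 _; rewrite gE' mulrC EFinM.
rewrite nneseriesZl; last by move=> m _; rewrite lee_fin.
by rewrite fE -EFinM mulrC.
Qed.

(** With u = th.1 + s and v = th.2 + t, the three strict inequalities put A / u, B / v and c / (u v)
    below 1, where the negative binomial series apply. *)
Lemma integral_FI_density_series {R : realType} (k a b l A B c s t : R) (th : R * R) :
  0 <= k -> 0 <= a -> 0 <= b -> 0 < l -> 0 <= A -> 0 <= B -> 0 <= c ->
  A < th.1 + s -> B < th.2 + t -> c < (th.1 + s) * (th.2 + t) ->
  (\int[@lebesgue_measure R \x @lebesgue_measure R]_x
     ((exp_form th x)%:E * FI_density_series k a b l A B c s t x) =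
   (k * Gamma (a + l) * Gamma (b + l) * (th.1 + s - A) `^ (- a) * (th.2 + t - B) `^ (- b)
    * ((th.1 + s) * (th.2 + t) - c) `^ (- l))%:E)%E.
Proof.
move=> k0 a0 b0 l0 A0 B0 c0 Au Bv cuv.
set u := th.1 + s in Au cuv *; set v := th.2 + t in Bv cuv *.
have u0 : 0 < u by exact: le_lt_trans Au.
have v0 : 0 < v by exact: le_lt_trans Bv.
have uv0 : 0 < u * v by exact: mulr_gt0.
have t0 m1 m2 m3 x : 0 <= FI_density_term k a b l A B c s t m1 m2 m3 x.
  by apply: FI_density_term_ge0 => //; exact: ltW.
rewrite /FI_density_series.
under eq_integral => x _.
  rewrite -nneseries3Zl; last by move=> *; rewrite lee_fin.
  over.
rewrite integral_nneseries3; last 2 first.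
- move=> m1 m2 m3; apply/measurable_EFinP; apply: measurable_funM.
    exact: measurable_exp_form.
  exact: measurable_FI_density_term.
- by move=> m1 m2 m3 x; rewrite lee_fin; apply: mulr_ge0; [exact: expR_ge0|exact: t0].
under eq_eseriesr => m1 _.
  under eq_eseriesr => m2 _.
    under eq_eseriesr => m3 _.
      under eq_integral do rewrite -EFinM.
      rewrite integral_FI_density_term// -/u -/v EFinM.
      over.
    over.
  over.
have nb r z m : 0 <= r -> 0 <= z -> 0 <= pochhammer r m * z ^+ m / m`!%:R :> R.
  by move=> r0 z0; rewrite divr_ge0// mulr_ge0 ?exprn_ge0// pochhammer_ge0.
have Au0 : 0 <= A / u by rewrite divr_ge0// ltW.
have Bv0 : 0 <= B / v by rewrite divr_ge0// ltW.
have cuv0 : 0 <= c / (u * v) by rewrite divr_ge0// ltW.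
rewrite nneseries3Zl; last first.
  move=> m1 m2 m3; rewrite lee_fin; apply: mulr_ge0; first exact: nb.
  by apply: mulr_ge0; apply: nb => //; exact: ltW.
have lt1 (z w : R) : 0 < w -> 0 <= z -> z < w -> 0 <= z / w < 1.
  by move=> w0 z0 zw; rewrite divr_ge0 ?(ltW w0)//= ltr_pdivrMr// mul1r.
have Sa := negative_binomial_series a (A / u) a0 (lt1 _ _ u0 A0 Au).
have Sb := negative_binomial_series b (B / v) b0 (lt1 _ _ v0 B0 Bv).
have Sl := negative_binomial_series l (c / (u * v)) (ltW l0) (lt1 _ _ uv0 c0 cuv).
rewrite (nneseries3M _ _ _ _ _ _ _ _ _ Sa Sb Sl); last 3 first.
- by move=> m; exact: nb.
- by move=> m; exact: nb.
- by move=> m; apply: nb => //; exact: ltW.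
rewrite -EFinM; congr EFin.
(* This identity merges the powers of u and v left by the Gamma integrals with the sums of the three
   series. *)
have pE (r z w : R) : 0 < w -> z < w -> w `^ r * (1 - z / w) `^ r = (w - z) `^ r.
  move=> w0 zw; rewrite -powRM ?(ltW w0)//; last by rewrite subr_ge0 ler_pdivrMr// mul1r ltW.
  by rewrite mulrBr mulr1 mulrCA divff ?mulr1// lt0r_neq0.
rewrite -(pE _ _ _ u0 Au) -(pE _ _ _ v0 Bv) -(pE _ _ _ uv0 cuv).
rewrite (powRM _ (ltW u0) (ltW v0)).
have powDN (y r q : R) : 0 < y -> y `^ (- (r + q)) = y `^ (- r) * y `^ (- q).
  by move=> y0; rewrite opprD (@powRD _ y (- r)) ?(gt_eqF y0) ?implybT.
rewrite !powDN//; ring.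
Qed.

Lemma FI_density_series_ge0 {R : realType} (k a b l A B c s t : R) (x : plane R) :
  0 <= k -> 0 <= a -> 0 <= b -> 0 <= l -> 0 <= A -> 0 <= B -> 0 <= c ->
  (0 <= FI_density_series k a b l A B c s t x)%E.
Proof.
move=> *; do 3 (apply: nneseries_ge0 => ? _ _).
by rewrite lee_fin FI_density_term_ge0.
Qed.

Lemma measurable_FI_density_series {R : realType} (k a b l A B c s t : R) :
  0 <= k -> 0 <= a -> 0 <= b -> 0 <= l -> 0 <= A -> 0 <= B -> 0 <= c ->
  measurable_fun setT (FI_density_series k a b l A B c s t).
Proof.
move=> *; apply: measurable_nneseries3 => [m1 m2 m3|m1 m2 m3 x].
  by apply/measurable_EFinP; exact: measurable_FI_density_term.
by rewrite lee_fin FI_density_term_ge0.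
Qed.

Lemma FI_density_series_out {R : realType} (k a b l A B c s t : R) (x : plane R) :
  ~ quadrant R x -> FI_density_series k a b l A B c s t x = 0%E.
Proof.
move=> xQ; do 3 (apply: eseries0 => ? _ _).
by rewrite /FI_density_term indicE memNset// mulr0.
Qed.

Lemma fine_FI_density_series {R : realType} (k a b l A B c s t : R) (x : plane R) :
  0 < k -> 0 <= a -> 0 <= b -> 0 <= l -> 0 <= A -> 0 <= B -> 0 <= c ->
  fine (FI_density_series k a b l A B c s t x) =
  k * x.1 `^ (a + l - 1) * x.2 `^ (b + l - 1) * expR (- (s * x.1 + t * x.2))
  * FI a b l (A * x.1) (B * x.2) (c * x.1 * x.2) * \1_(quadrant R) x.
Proof.
move=> k0 a0 b0 l0 A0 B0 c0.
have [xQ|xQ] := pselect (quadrant R x); last first.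
  by rewrite FI_density_series_out// indicE memNset// mulr0.
rewrite indicE mem_set// mulr1 /FI.
move: (xQ) => -[]; rewrite /= !in_itv/= !andbT => x1 x2.
set w := k * _ * _ * _.
have w0 : 0 < w by rewrite !mulr_gt0 ?powR_gt0 ?expR_gt0.
rewrite (_ : FI_density_series _ _ _ _ _ _ _ _ _ _ = (w%:E *
    \sum_(0 <= m1 <oo) \sum_(0 <= m2 <oo) \sum_(0 <= m3 <oo)
      (FI_term a b l (A * x.1) (B * x.2) (c * x.1 * x.2) m1 m2 m3)%:E)%E).
  set S := (\sum_(0 <= m1 <oo) _)%E.
  have S0 : (0 <= S)%E.
    by do 3 (apply: nneseries_ge0 => ? _ _); rewrite lee_fin FI_term_ge0// ?mulr_ge0// ltW.
  (* If the series is infinite, so is its product with w > 0, and [fine] sends both to 0; the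
     identity thus holds whether or not the series converges at [x]. *)
  by case: S S0 => [S| |]//= _; rewrite gt0_muley ?lte_fin//= mulr0.
rewrite -nneseries3Zl; last first.
  by move=> m1 m2 m3; rewrite lee_fin FI_term_ge0// ?mulr_ge0// ltW.
apply: eq_eseriesr => m1 _; apply: eq_eseriesr => m2 _; apply: eq_eseriesr => m3 _.
by rewrite /FI_density_term indicE mem_set// mulr1 -EFinM.
Qed.

(** The last three inequalities are the case th = 0: they make the integral of the series finite, so
    the series is finite almost everywhere and [fine] alters it only on a null set. *)
Lemma integral_fine_FI_density_series {R : realType} (k a b l A B c s t : R) (th : R * R) :
  0 < k -> 0 <= a -> 0 <= b -> 0 < l -> 0 <= A -> 0 <= B -> 0 <= c ->
  A < th.1 + s -> B < th.2 + t -> c < (th.1 + s) * (th.2 + t) ->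
  A < s -> B < t -> c < s * t ->
  (\int[@lebesgue_measure R \x @lebesgue_measure R]_x
     ((exp_form th x)%:E * (fine (FI_density_series k a b l A B c s t x))%:E) =
   (k * Gamma (a + l) * Gamma (b + l) * (th.1 + s - A) `^ (- a) * (th.2 + t - B) `^ (- b)
    * ((th.1 + s) * (th.2 + t) - c) `^ (- l))%:E)%E.
Proof.
move=> k0 a0 b0 l0 A0 B0 c0 Au Bv cuv As Bt cst.
rewrite -(integral_FI_density_series k a b l A B c s t th)//; last exact: ltW.
set lam2 := (lebesgue_measure \x lebesgue_measure)%E.
pose S := FI_density_series k a b l A B c s t.
have mS : measurable_fun setT S by apply: measurable_FI_density_series => //; exact: ltW.
have S0 x : (0 <= S x)%E by apply: FI_density_series_ge0 => //; exact: ltW.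
have iS : lam2.-integrable setT S.
  apply/integrableP; split=> //.
  under eq_integral do rewrite gee0_abs//.
  rewrite (_ : (\int[_]_x _)%E = (\int[lam2]_x ((exp_form (0, 0) x)%:E * S x))%E); last first.
    by apply: eq_integral => x _; rewrite /exp_form/= !mul0r addr0 oppr0 expR0 mul1e.
  by rewrite integral_FI_density_series ?add0r ?ltry//; exact: ltW.
have mE : measurable_fun setT (fun x => (exp_form th x)%:E).
  by apply/measurable_EFinP; exact: measurable_exp_form.
apply: ae_eq_integral => //.
- apply: emeasurable_funM => //; apply/measurable_EFinP.
  exact: measurableT_comp.
- exact: emeasurable_funM.
apply: ae_eqe_mul2l.
have := integrable_ae measurableT iS; apply: filterS => x /(_ I) Sx _.
by rewrite /= fineK.
Qed.

(** * Specialisation to the parameters of P *)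

Lemma FI_density_mfg_formula {R : realType} (p1 p2 p12 c lam lam1 lam2 : R)
    (th : R * R) :
  0 < p1 -> 0 < p2 -> 0 < p12 -> c = (p1 * p2 - p12) / p12 ^+ 2 -> 0 < c ->
  mfg_domain p1 p2 p12 th ->
  let u := th.1 + p2 / p12 in let v := th.2 + p1 / p12 in
  [/\ c * (p12 / p1) < u, c * (p12 / p2) < v, c < u * v &
    p12 `^ (- lam) * p1 `^ (- (lam1 - lam)) * p2 `^ (- (lam2 - lam))
      * (u - c * (p12 / p1)) `^ (- (lam1 - lam))
      * (v - c * (p12 / p2)) `^ (- (lam2 - lam))
      * (u * v - c) `^ (- lam)
    = mfg_formula p1 p2 p12 lam lam1 lam2 th].
Proof.
move=> p1_gt0 p2_gt0 p12_gt0 cE c_gt0 [Pth th1 th2] u v.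
have p1n0 := lt0r_neq0 p1_gt0; have p2n0 := lt0r_neq0 p2_gt0.
have p12n0 := lt0r_neq0 p12_gt0.
(* Here c p12 / p1 = p2 / p12 - 1 / p1, so subtracting it from u leaves th.1 + 1 / p1. *)
have uE : p1 * (u - c * (p12 / p1)) = 1 + p1 * th.1.
  by rewrite cE /u; field; rewrite p1n0.
have vE : p2 * (v - c * (p12 / p2)) = 1 + p2 * th.2.
  by rewrite cE /v; field; rewrite p2n0.
have uvE : p12 * (u * v - c) = affine2 p1 p2 p12 th.
  by rewrite cE /u /v /affine2; field.
have u0 : 0 < u - c * (p12 / p1) by rewrite -(pmulr_rgt0 _ p1_gt0) uE.
have v0 : 0 < v - c * (p12 / p2) by rewrite -(pmulr_rgt0 _ p2_gt0) vE.
have uv0 : 0 < u * v - c by rewrite -(pmulr_rgt0 _ p12_gt0) uvE.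
split; [by rewrite -subr_gt0|by rewrite -subr_gt0|by rewrite -subr_gt0|].
rewrite /mfg_formula -uE -vE -uvE.
rewrite (powRM _ (ltW p1_gt0) (ltW u0)) (powRM _ (ltW p2_gt0) (ltW v0)).
rewrite (powRM _ (ltW p12_gt0) (ltW uv0)).
(* The powers are generalised so that [ring] sees them as atoms. *)
move: (p12 `^ _) => x1; move: (p1 `^ _) => x2; move: (p2 `^ _) => x3.
move: ((u - _) `^ _) => x4; move: ((v - _) `^ _) => x5; move: (_ `^ _) => x6; ring.
Qed.

Lemma mfg_domain_ge0 {R : realType} (p1 p2 p12 : R) (th : R * R) :
  0 < p1 -> 0 < p2 -> 0 < p12 -> 0 <= th.1 -> 0 <= th.2 ->
  mfg_domain p1 p2 p12 th.
Proof.
move=> p1_gt0 p2_gt0 p12_gt0 th1 th2; rewrite /mfg_domain /affine2/=.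
have ? : 0 <= p1 * th.1 by rewrite mulr_ge0// ltW.
have ? : 0 <= p2 * th.2 by rewrite mulr_ge0// ltW.
have ? : 0 <= p12 * th.1 * th.2 by rewrite mulr_ge0// mulr_ge0// ltW.
by split; lra.
Qed.

Theorem theorem3 (R : realType) (p1 p2 p12 c lam lam1 lam2 : R)
    (p1_gt0 : 0 < p1) (p2_gt0 : 0 < p2) (p12_gt0 : 0 < p12)
    (cE : c = (p1 * p2 - p12) / p12 ^+ 2) (c_gt0 : 0 < c)
    (lam_gt0 : 0 < lam) (lam1_ge : lam <= lam1) (lam2_ge : lam <= lam2) :
  (exists mu : probability (plane R) R,
      is_multi_factor_gamma p1 p2 p12 lam lam1 lam2 mu) /\
  (forall mu : probability (plane R) R,
      is_multi_factor_gamma p1 p2 p12 lam lam1 lam2 mu ->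
      forall A : set (plane R), measurable A ->
        mu A = \int[@lebesgue_measure R \x @lebesgue_measure R]_(x in A)
          (p12 `^ (- lam) * p1 `^ (- (lam1 - lam)) * p2 `^ (- (lam2 - lam))
             / (Gamma lam1 * Gamma lam2)
           * x.1 `^ (lam1 - 1) * x.2 `^ (lam2 - 1)
           * expR (- (p2 / p12 * x.1 + p1 / p12 * x.2))
           * FI (lam1 - lam) (lam2 - lam) lam
               (c * (p12 / p1) * x.1) (c * (p12 / p2) * x.2) (c * x.1 * x.2)
           * \1_(`]0, +oo[ `*` `]0, +oo[) x)%:E)%E.
Proof.
have a0 : 0 <= lam1 - lam by rewrite subr_ge0.
have b0 : 0 <= lam2 - lam by rewrite subr_ge0.
have G1 : 0 < Gamma lam1 by apply: Gamma_gt0; exact: lt_le_trans lam1_ge.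
have G2 : 0 < Gamma lam2 by apply: Gamma_gt0; exact: lt_le_trans lam2_ge.
have A0 : 0 <= c * (p12 / p1) by rewrite mulr_ge0 ?divr_ge0 ?ltW.
have B0 : 0 <= c * (p12 / p2) by rewrite mulr_ge0 ?divr_ge0 ?ltW.
set k := _ / (Gamma lam1 * Gamma lam2).
have k0 : 0 < k by rewrite divr_gt0 ?mulr_gt0 ?powR_gt0.
have pp : p12 < p1 * p2.
  by move: c_gt0; rewrite cE pmulr_lgt0 ?invr_gt0 ?exprn_gt0// subr_gt0.
pose S := FI_density_series k (lam1 - lam) (lam2 - lam) lam
  (c * (p12 / p1)) (c * (p12 / p2)) c (p2 / p12) (p1 / p12).
pose f x := fine (S x).
have fE x : f x = k * x.1 `^ (lam1 - 1) * x.2 `^ (lam2 - 1)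
    * expR (- (p2 / p12 * x.1 + p1 / p12 * x.2))
    * FI (lam1 - lam) (lam2 - lam) lam
        (c * (p12 / p1) * x.1) (c * (p12 / p2) * x.2) (c * x.1 * x.2)
    * \1_(`]0, +oo[ `*` `]0, +oo[) x.
  by rewrite /f /S fine_FI_density_series ?subrK// ltW.
have f0 x : 0 <= f x.
  by apply: fine_ge0; apply: FI_density_series_ge0 => //; exact: ltW.
have mf : measurable_fun setT f.
  by apply: measurableT_comp => //; apply: measurable_FI_density_series => //; exact: ltW.
have D0 : mfg_domain p1 p2 p12 (0, 0) by exact: mfg_domain_ge0.
have intE th : mfg_domain p1 p2 p12 th ->
    (\int[@lebesgue_measure R \x @lebesgue_measure R]_x
      ((exp_form th x)%:E * (f x)%:E) = (mfg_formula p1 p2 p12 lam lam1 lam2 th)%:E)%E.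
  move=> Dth.
  have formula th' := FI_density_mfg_formula p1 p2 p12 c lam lam1 lam2 th'
    p1_gt0 p2_gt0 p12_gt0 cE c_gt0.
  have [A1 B1 c1 E] := formula th Dth.
  (* The inequalities at theta = 0 secure almost-everywhere finiteness of the series. *)
  have [A2 B2 c2 _] := formula _ D0.
  rewrite /= !add0r in A2 B2 c2.
  rewrite integral_fine_FI_density_series ?(ltW c_gt0)// -E !subrK; congr EFin.
  rewrite /k; field.
  by rewrite !lt0r_neq0.
(* The total mass is the transform at 0, where the formula has the value 1. *)
have f1 : (\int[@lebesgue_measure R \x @lebesgue_measure R]_x (f x)%:E = 1)%E.
  have := intE _ D0; rewrite /mfg_formula /affine2/= !mulr0 !addr0 !powR1 !mulr1 => <-.
  by apply: eq_integral => x _; rewrite /exp_form/= !mul0r addr0 oppr0 expR0 mul1e.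
have [nu nuE] := probability_of_density _ _ mf f0 f1.
have nuL th : mfg_domain p1 p2 p12 th ->
    laplace nu th = (mfg_formula p1 p2 p12 lam lam1 lam2 th)%:E.
  move=> Dth; rewrite -intE// laplaceE.
  rewrite (ge0_integral_density _ _ _ _ sigma_finite_lebesgue_plane mf f0)//.
  - by apply/measurable_EFinP; exact: measurable_exp_form.
  - by move=> x; rewrite lee_fin expR_ge0.
have nuQ : nu (~` (`]0, +oo[ `*` `]0, +oo[)) = 0%E.
  rewrite nuE; apply: integral0_eq => x xQ.
  by rewrite fE indicE memNset// mulr0.
split.
  (* The open positive quadrant serves as the set of theta: it lies in the domain by
     [mfg_domain_ge0] and has (1, 1) in its interior. *)
  exists nu, [set th | 0 < th.1 /\ 0 < th.2]; split.
  - exists (1, 1); exists ([set x | 0 < x], [set x | 0 < x]) => //=.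
    by split; exact: lt_nbhsr.
  - by move=> th [th1 th2]; apply: mfg_domain_ge0 => //; exact: ltW.
  - by move=> th [th1 th2]; apply: nuL; apply: mfg_domain_ge0 => //; exact: ltW.
move=> mu muE A mA.
rewrite (is_multi_factor_gamma_unique p1 p2 p12 lam lam1 lam2 mu nu)// nuE.
by apply: eq_integral => x _; rewrite fE.
Qed.
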